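(* There is an algorithm that solves every connectivity game $\mathcal G=(V_0,V_1,E,\{V\})$, $V=V_0\cup V_1$, in time $O\big((|V_1|+|V_0|)\cdot|V_0|\log|V_0|\big)$.
   Context: Connectivity game: $V_0,V_1$ are disjoint finite sets, $V=V_0\cup V_1$, $E\subseteq (V_0\times V_1)\cup(V_1\times V_0)$. A token starts at some vertex; whenever the token is at $v\in V_\sigma$, player $\sigma\in\{0,1\}$ moves it along an edge of $E$ out of $v$. If a vertex with no outgoing edge is reached, player 1 wins. An infinite play is won by player 0 if every vertex of $V$ is visited infinitely often, and by player 1 otherwise. To solve the game means to find, given $V_0,V_1,E$, the sets $Win_0$ and $Win_1$ of starting vertices from which player 0, respectively player 1, has a winning strategy (equivalently, to decide whether player 0 wins from every vertex). Running time is worst-case time in the usual random-access model. *)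

(* Defs.v *)
From mathcomp Require Import all_boot.

Set Implicit Arguments.
Unset Strict Implicit.
Unset Printing Implicit Defensive.

(** * Connectivity games *)

Inductive player := P0 | P1.

(* The vertex set is the disjoint union [V0 + V1]. *)
Definition owner (V0 V1 : Type) (v : V0 + V1) : player :=
  if v is inl _ then P0 else P1.

Record connectivity_game := ConnectivityGame {
  V0 : finType;
  V1 : finType;
  E : {set (V0 + V1) * (V0 + V1)};
  E_bipartite : forall u v, (u, v) \in E -> owner u <> owner v
}.

Definition vertex (G : connectivity_game) : finType := (V0 G + V1 G)%type.

Section Games.
Variable G : connectivity_game.
Notation V := (vertex G).

Definition edge : rel V := fun u v => (u, v) \in E G.

Definition dead_end (v : V) : bool := [forall w, ~~ edge v w].

(* [Finite x p] visits the vertices of [x :: p] in this order. *)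
Inductive play :=
  | Finite of V & seq V
  | Infinite of nat -> V.

Definition start (r : play) : V :=
  match r with Finite x _ => x | Infinite f => f 0 end.

(* Finite plays are maximal: they stop only where no move is possible. *)
Definition is_play (r : play) : Prop :=
  match r with
  | Finite x p => path edge x p /\ dead_end (last x p)
  | Infinite f => forall i, edge (f i) (f i.+1)
  end.

Definition won_by_P0 (r : play) : Prop :=
  match r with
  | Finite _ _ => False
  | Infinite f => forall (v : V) (m : nat), exists2 i, m <= i & f i = v
  end.

Definition won_by (a : player) (r : play) : Prop :=
  match a with P0 => won_by_P0 r | P1 => ~ won_by_P0 r end.

(* A strategy maps the history of the play, up to and including the current
   vertex, to the next vertex.  Its value is irrelevant on histories ending in
   a dead end or in a vertex of the opponent. *)
Definition strategy := seq V -> V.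

(* Without this condition an illegal move would leave no conforming play, and
   the strategy would win vacuously. *)
Definition legal (a : player) (s : strategy) : Prop :=
  forall (x : V) (h : seq V),
    owner (last x h) = a -> ~~ dead_end (last x h) ->
    edge (last x h) (s (x :: h)).

Definition conforms (a : player) (s : strategy) (r : play) : Prop :=
  match r with
  | Finite x p => forall i, i < size p -> owner (nth x (x :: p) i) = a ->
      nth x (x :: p) i.+1 = s (take i.+1 (x :: p))
  | Infinite f => forall i, owner (f i) = a -> f i.+1 = s (mkseq f i.+1)
  end.

Definition winning_strategy (a : player) (v : V) (s : strategy) : Prop :=
  legal a s /\
  forall r, is_play r -> start r = v -> conforms a s r -> won_by a r.

Definition Win (a : player) (v : V) : Prop :=
  exists s, winning_strategy a v s.

End Games.

(** * Random-access machines *)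

(* Unit-cost machine with directly addressed registers and an indirectly
   addressed memory, both holding natural numbers.  Registers are named by
   constants, so that a program uses only finitely many of them. *)
Inductive instr :=
  | IConst of nat & nat        (* r_i := c *)
  | IAdd of nat & nat & nat    (* r_i := r_j + r_k *)
  | ISub of nat & nat & nat    (* r_i := r_j - r_k, truncated at 0 *)
  | ILoad of nat & nat         (* r_i := memory[r_j] *)
  | IStore of nat & nat        (* memory[r_i] := r_j *)
  | IJump of nat               (* goto l *)
  | IJumpZ of nat & nat.       (* if r_i = 0 goto l *)

Definition program := seq instr.

Record config := Config { pc : nat; register : nat -> nat; memory : nat -> nat }.

Definition exec (i : instr) (c : config) : config :=
  let: Config l r m := c in
  match i with
  | IConst i k => Config l.+1 [eta r with i |-> k] m
  | IAdd i j k => Config l.+1 [eta r with i |-> r j + r k] m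
  | ISub i j k => Config l.+1 [eta r with i |-> r j - r k] m
  | ILoad i j => Config l.+1 [eta r with i |-> m (r j)] m
  | IStore i j => Config l.+1 r [eta m with r i |-> r j]
  | IJump l' => Config l' r m
  | IJumpZ i l' => Config (if r i == 0 then l' else l.+1) r m
  end.

(* The machine halts by leaving the program. *)
Definition halted (p : program) (c : config) : bool := size p <= pc c.

Definition step (p : program) (c : config) : config :=
  if onth p (pc c) is Some i then exec i c else c.

Definition run (p : program) (t : nat) (c : config) : config :=
  iter t (step p) c.

Definition initial (input : seq nat) : config :=
  Config 0 (fun=> 0) (nth 0 input).

(* Unit cost is only realistic for words of bounded length. *)
Definition words_le (B : nat) (c : config) : Prop :=
  forall i, register c i <= B /\ memory c i <= B.

(** * Input and output *)

Section Encoding.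
Variable G : connectivity_game.

(* [V0] is numbered 0, ..., |V0| - 1 and [V1] is numbered from |V0| on. *)
Definition code (v : vertex G) : nat :=
  match v with
  | inl u => enum_rank u
  | inr w => #|V0 G| + enum_rank w
  end.

(* Any duplicate-free listing of the edges is an admissible input. *)
Definition lists_edges (es : seq (vertex G * vertex G)) : Prop :=
  uniq es /\ es =i E G.

Definition encode (es : seq (vertex G * vertex G)) : seq nat :=
  [:: #|V0 G|, #|V1 G|, size es
    & flatten [seq [:: code e.1; code e.2] | e <- es]].

Definition indicates (b : nat) (P : Prop) : Prop :=
  (b = 1 /\ P) \/ (b = 0 /\ ~ P).

(* The output consists of the characteristic vectors of the winning regions of
   the two players, one after the other, from address 0 on. *)
Definition outputs_winning_regions (c : config) : Prop :=
  forall v : vertex G,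
    indicates (memory c (code v)) (Win P0 v) /\
    indicates (memory c (#|V0 G| + #|V1 G| + code v)) (Win P1 v).

End Encoding.

(* (n1 + n0) * n0 * log n0, where factors equal to 0 (which occur only for
   n0 <= 1) are replaced by 1: even a trivial game needs time to be answered.
   Rounding the logarithm down changes it by a factor of at most 2. *)
Definition time_bound (n0 n1 : nat) : nat :=
  maxn 1 (n1 + n0) * maxn 1 n0 * maxn 1 (trunc_log 2 n0).

(* Main.v *)
(** Player 0 wins from every vertex or from none, and he wins iff he can force
    the token from each vertex of [V0] to each other one and every vertex of
    [V1] has an incoming and an outgoing edge.  If player 0 can force his way
    between any two vertices of each class of a partition of [V0], then he can
    force a class [T] from outside iff some [w] in [V1] has all its successors
    in [T] and a predecessor [x] outside: if there is none, player 1 keeps the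
    token out of [T] forever.  So walk backwards along such [x], keeping the
    classes met on a stack.  A new class is pushed; a class already on the stack
    closes a cycle, and the two topmost classes are merged.  With edge counts
    kept per class and per vertex of [V1], each of the at most [2 |V0|] rounds
    costs [O(|V|)], since rows of counts are added when classes are merged; the
    logarithmic factor is not needed. *)

Require Import Defs.
From mathcomp Require Import all_boot.
From mathcomp Require Import zify.

Set Implicit Arguments.
Unset Strict Implicit.
Unset Printing Implicit Defensive.

(** * Attractors and winning strategies *)

(** Merging just two classes is sound: with [t] on top of the stack and [p] right below it, forcing
    leads from [t] to [p], from [p] down to the class [u] that was met again, and through the pivot
    from [u] back to [t]. Hence [t] and [p] force each other; the rest of the cycle is left to later
    rounds. An absorbed class gets a zero row, which hides it from later searches, and keeps its
    nonzero link. As no link is ever erased, each vertex is pushed at most once, which bounds the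
    rounds. Whether an edge has its end outside a class is tested in constant time, by subtracting
    the row of the class from the row of totals. That the two regions are complementary comes from
    two facts: one player is shown to win everywhere, and opposing winning strategies from one
    vertex contradict each other. Time and word size are proved along with correctness, by triples
    that carry a step count and a bound on the words of every intermediate configuration. *)

Lemma mkseq_cons (T : Type) (f : nat -> T) n :
  mkseq f n.+1 = f 0 :: mkseq (f \o S) n.
Proof. by rewrite /mkseq /= (iotaDl 1 0) -map_comp. Qed.

Section Games.
Variable G : connectivity_game.
Notation V := (vertex G).
Notation edge := (@edge G).
Notation dead_end := (@dead_end G).
Implicit Types (u v w t : V) (f : nat -> V).

Lemma dead_endPn v : reflect (exists w, edge v w) (~~ dead_end v).
Proof.
apply: (iffP idP) => [|[w vw]].
  by rewrite negb_forall => /existsP[w]; rewrite negbK; exists w.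
by apply/forallP => /(_ w); rewrite vw.
Qed.

Definition prefer (v : V) (P : pred V) : V :=
  if [pick w | edge v w && P w] is Some w then w
  else odflt v [pick w | edge v w].

Lemma prefer_edge v P : ~~ dead_end v -> edge v (prefer v P).
Proof.
case/dead_endPn=> w0 vw0; rewrite /prefer; case: pickP => [w /andP[]//|_].
by case: pickP => [//|/(_ w0)]; rewrite vw0.
Qed.

Lemma preferP v w (P : pred V) : edge v w -> P w -> P (prefer v P).
Proof.
move=> vw Pw; rewrite /prefer; case: pickP => [w' /andP[]//|/(_ w)].
by rewrite vw Pw.
Qed.

Lemma edge_owner u v : edge u v -> owner u <> owner v.
Proof. exact: E_bipartite. Qed.

(** * Opposing winning strategies exclude each other *)

Section Clash.
Variables (v : V) (s0 s1 : strategy G).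
Hypothesis win0 : winning_strategy P0 v s0.
Hypothesis win1 : winning_strategy P1 v s1.

Let next (h : seq V) : V := if owner (last v h) is P0 then s0 h else s1 h.

Fixpoint clash_hist n : seq V :=
  if n is k.+1 then rcons (clash_hist k) (next (clash_hist k)) else [:: v].

Let f n := last v (clash_hist n).

Lemma clash_histE n : clash_hist n = mkseq f n.+1.
Proof. by elim: n => //= n IHn; rewrite mkseqS -IHn /f /= last_rcons. Qed.

Lemma clash_step n : f n.+1 = if owner (f n) is P0 then s0 (mkseq f n.+1)
                              else s1 (mkseq f n.+1).
Proof. by rewrite -clash_histE {1}/f /= last_rcons. Qed.

Lemma clash_edge n : ~~ dead_end (f n) -> edge (f n) (f n.+1).
Proof.
rewrite clash_step => live.
have last_f : last v (mkseq (f \o S) n) = f n.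
  by case: n {live} => // n; rewrite mkseqS last_rcons.
have hE : mkseq f n.+1 = v :: mkseq (f \o S) n by rewrite mkseq_cons.
rewrite -last_f in live *; rewrite hE.
case own: (owner _); first exact: (proj1 win0 v (mkseq (f \o S) n)).
exact: (proj1 win1 v (mkseq (f \o S) n)).
Qed.

(** A first dead end would complete a finite play conforming to [s0], and player 0 loses every
    finite play. *)
Lemma clash_live n : ~~ dead_end (f n).
Proof.
elim/ltn_ind: n => n IHn; apply/negP => dead.
have hE k : mkseq f k.+1 = v :: mkseq (f \o S) k by rewrite mkseq_cons.
apply: (proj2 win0 (Defs.Finite v (mkseq (f \o S) n))) => //=.
- split; last first.
    by case: n dead {IHn} => // n; rewrite mkseqS last_rcons.
  apply/(pathP v) => i; rewrite size_mkseq => lt_in.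
  rewrite -hE !nth_mkseq ?ltnS ?(ltnW lt_in) //=.
  exact/clash_edge/IHn.
- move=> i; rewrite size_mkseq => lt_in.
  rewrite -[nth _ (_ :: _) i]/(nth v (v :: mkseq (f \o S) n) i) -hE.
  rewrite nth_mkseq ?ltnS ?(ltnW lt_in) // nth_mkseq //= => own.
  rewrite clash_step own; congr s0.
  rewrite -[v :: take _ _]/(take i.+1 (v :: mkseq (f \o S) n)) -hE.
  by rewrite /mkseq -map_take take_iota (minn_idPl _) // ltnS ltnW.
Qed.

Lemma clash : False.
Proof.
have play_f : is_play (Infinite f) by move=> i; exact/clash_edge/clash_live.
have c0 : conforms P0 s0 (Infinite f) by move=> i own; rewrite clash_step own.
have c1 : conforms P1 s1 (Infinite f) by move=> i own; rewrite clash_step own.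
exact: (proj2 win1 _ play_f erefl c1 (proj2 win0 _ play_f erefl c0)).
Qed.

End Clash.

Lemma Win_exclusive v : Win P0 v -> Win P1 v -> False.
Proof. by move=> [s0 win0] [s1 win1]; exact: clash win0 win1. Qed.

(** * Attractors of a single vertex *)

Fixpoint attr t n : pred V :=
  if n is k.+1 then fun v => attr t k v ||
    (if owner v is P0 then [exists w, edge v w && attr t k w]
     else ~~ dead_end v && [forall w, edge v w ==> attr t k w])
  else pred1 t.

Definition forces v t : Prop := exists n, attr t n v.

Lemma attr_leq t n m v : n <= m -> attr t n v -> attr t m v.
Proof.
by move/subnK <-; elim: (m - n) => //= k IHk av; rewrite IHk.
Qed.

Lemma forces_refl v : forces v v.
Proof. by exists 0; rewrite /= eqxx. Qed.

Lemma forces_P0 u v t : owner u = P0 -> edge u v -> forces v t -> forces u t.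
Proof.
move=> own uv [n av]; exists n.+1 => /=; rewrite own.
by apply/orP; right; apply/existsP; exists v; rewrite uv.
Qed.

(** Each successor comes with its own number of rounds; as they are finitely many, the maximum
    serves all of them. A dead end would satisfy the quantifier vacuously, although player 1 has won
    there. *)
Lemma forces_P1 u t : owner u = P1 -> ~~ dead_end u ->
  (forall v, edge u v -> forces v t) -> forces u t.
Proof.
move=> own live all_f.
have [n nP] : exists n, forall v, v \in enum V -> edge u v -> attr t n v.
  elim: (enum V) => [|x s [n nP]]; first by exists 0.
  have [k kP] : exists k, edge u x -> attr t k x.
    by case ux: (edge u x); [case: (all_f _ ux) => k; exists k | exists 0].
  exists (maxn n k) => v; rewrite inE => /predU1P[->|sv] uv.
    exact/(attr_leq (leq_maxr n k))/kP.
  exact/(attr_leq (leq_maxl n k))/nP.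
exists n.+1 => /=; rewrite own live; apply/orP; right.
by apply/forallP => v; apply/implyP => /nP; apply; rewrite mem_enum.
Qed.

Lemma forces_trans : forall v u t, forces u v -> forces v t -> forces u t.
Proof.
move=> v u t [n]; elim: n u => [|n IHn] u /=; first by move/eqP->.
case/orP=> [/IHn//|]; case own: (owner u).
  by case/existsP=> w /andP[uw aw] vt; apply: forces_P0 own uw (IHn _ aw vt).
case/andP=> live /forallP all_w vt; apply: forces_P1 => // w uw.
by apply: IHn vt; apply: (implyP (all_w w)).
Qed.

Lemma forces_live u v : u != v -> forces u v -> ~~ dead_end u.
Proof.
move=> neq_uv [n]; elim: n => [|n IHn] /=; first by rewrite (negPf neq_uv).
case/orP=> [//|]; case: (owner u) => [/existsP[w /andP[uw _]]|/andP[]//].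
by apply/dead_endPn; exists w.
Qed.

(** * From forcing to a winning strategy of player 0 *)

Section ForcingWins.
Hypothesis forces_all : forall v t, forces v t.
Hypothesis live_all : forall v, ~~ dead_end v.

Let rank t v := ex_minn (forces_all v t).

Lemma attr_rank t v : attr t (rank t v) v.
Proof. by rewrite /rank; case: ex_minnP. Qed.

Lemma rank_min t v n : attr t n v -> rank t v <= n.
Proof. by rewrite /rank; case: ex_minnP => k _ kP /kP. Qed.

(** Since the rank is minimal, [v] is not in the preceding attractor stage, so the one-move
    alternative of [attr] must hold. *)
Lemma rank_step t v : v != t ->
  if owner v is P0 then exists2 w, edge v w & rank t w < rank t v
  else forall w, edge v w -> rank t w < rank t v.
Proof.
move=> neq_vt; have := attr_rank t v; have := @rank_min t v.
case: (rank t v) => [|n] min_n /=; first by rewrite (negPf neq_vt).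
case/orP=> [/min_n|]; first by rewrite ltnn.
case: (owner v) => [/existsP[w /andP[vw aw]]|/andP[_ /forallP av] w vw].
  by exists w => //; rewrite ltnS rank_min.
by rewrite ltnS; apply/rank_min/(implyP (av w)).
Qed.

Variable v0 : V.

(* Player 0 attracts the token to the targets in turn; the mode counts the
   targets reached so far along the history. *)
Let target i : V := nth v0 (enum V) (i %% #|V|).
Let mode (h : seq V) : nat :=
  foldl (fun i v => if v == target i then i.+1 else i) 0 h.

Let move (h : seq V) : V :=
  let v := last v0 h in let t := target (mode h) in
  prefer v (fun w => rank t w < rank t v).

Lemma move_legal : legal P0 move.
Proof. by move=> x h _; apply: prefer_edge. Qed.

Variable f : nat -> V.
Hypothesis play_f : is_play (Infinite f).
Hypothesis conf_f : conforms P0 move (Infinite f).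

Let md i := mode (mkseq f i.+1).

Lemma mode_step i :
  md i.+1 = if f i.+1 == target (md i) then (md i).+1 else md i.
Proof.
by rewrite {1}/md mkseqS /mode -cats1 foldl_cat.
Qed.

Lemma rank_decr i : f i != target (md i) ->
  rank (target (md i)) (f i.+1) < rank (target (md i)) (f i).
Proof.
move=> /rank_step; case own: (owner (f i)); last by apply; exact: play_f.
case=> w vw lt_w; rewrite (conf_f own) /move mkseqS last_rcons -mkseqS -/(md i).
exact: (@preferP _ _ (fun w => rank _ w < rank _ (f i)) vw lt_w).
Qed.

(** Until the target is reached the mode, hence the target, stays fixed while the rank decreases.
    The induction looks at position [i.+1] because [md i] already accounts for [f i]. *)
Lemma next_target i :
  exists j, [/\ i < j, f j = target (md i) & md j = (md i).+1].
Proof.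
have [k] := ubnP (rank (target (md i)) (f i.+1)).
elim: k i => // k IHk i lt_k.
have [ft|neq_t] := eqVneq (f i.+1) (target (md i)).
  by exists i.+1; split; rewrite // mode_step ft eqxx.
have md_i : md i.+1 = md i by rewrite mode_step (negPf neq_t).
have [|j [lt_ij ft mdj]] := IHk i.+1.
  rewrite md_i; apply: leq_trans (_ : rank (target (md i)) (f i.+1) <= k) => //.
  by have := @rank_decr i.+1; rewrite md_i; apply.
by exists j; rewrite -md_i; split=> //; exact: ltnW.
Qed.

Lemma visits_all v m : exists2 i, m <= i & f i = v.
Proof.
have reach_mode d : exists2 i, m <= i & md i = md m + d.
  elim: d => [|d [i le_mi mdi]]; first by exists m; rewrite ?addn0.
  have [j [lt_ij _ mdj]] := next_target i.
  by exists j; rewrite ?(leq_trans le_mi (ltnW lt_ij)) // mdj mdi addnS.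
pose k := index v (enum V).
have lt_k : k < #|V| by rewrite cardE index_mem mem_enum.
have card_gt0 : 0 < #|V| by apply: leq_trans lt_k.
(* The mode to wait for must be congruent to [k] modulo [#|V|], so that the target is [v], and at
   least [md m]; the number [md m * #|V| + k] is both. *)
have [i le_mi mdi] := reach_mode (md m * #|V| + k - md m).
have [j [lt_ij fj _]] := next_target i.
exists j; first exact: leq_trans le_mi (ltnW lt_ij).
have le_md : md m <= md m * #|V| + k.
  by apply: leq_trans (leq_addr _ _); rewrite leq_pmulr.
rewrite fj mdi subnKC // /target modnMDl modn_small // nth_index //.
by rewrite mem_enum.
Qed.

End ForcingWins.

Lemma forces_Win_P0 : (forall v t, forces v t) -> (forall v, ~~ dead_end v) ->
  forall v, Win P0 v.
Proof.
move=> forces_all live_all v.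
eexists; split; first exact: (move_legal forces_all v).
case=> [x p [_ dead]|f play_f _ conf_f]; first by have := live_all (last x p);
  rewrite dead.
move=> w m; exact: visits_all play_f conf_f w m.
Qed.

(** * Winning strategies of player 1 *)

Lemma never_won_Win_P1 v : (forall r : play G, is_play r -> ~ won_by_P0 r) ->
  Win P1 v.
Proof.
move=> never; exists (fun h => prefer (last v h) pred0).
split=> [x h _|r play_r _ _]; [exact: prefer_edge | exact: never].
Qed.

(* Player 1 never enters [T] from outside, so that either [T] or the rest of
   [V0] is eventually avoided. *)
Lemma trap_Win_P1 (T : pred (V0 G)) x0 y0 :
  T x0 -> ~~ T y0 ->
  (forall (x : V0 G) (w : V1 G), ~~ T x -> edge (inl x) (inr w) ->
     exists2 y, ~~ T y & edge (inr w) (inl y)) ->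
  forall v, Win P1 v.
Proof.
move=> Tx0 Ty0 escape v.
pose out u := if u is inl x then ~~ T x else false.
exists (fun h => prefer (last v h) out).
split=> [x h _|]; first exact: prefer_edge.
case=> [x p _ _ _ []|f] play_f _ conf_f won.
have out_step i : out (f i) -> out (f i.+2).
  case fi: (f i) => [x|//] /= Tx.
  have := play_f i; rewrite fi; case fi1: (f i.+1) => [y|w] xw.
    by case: (edge_owner xw).
  have [y Ty wy] := escape _ _ Tx xw.
  have := conf_f i.+1; rewrite fi1 => /(_ erefl) ->.
  rewrite mkseqS last_rcons fi1; exact: (@preferP _ (inl y) out wy Ty).
have [i _ fi] := won (inl y0) 0.
have out_from k : out (f (i + k.*2)).
  elim: k => [|k IHk]; first by rewrite addn0 fi.
  by rewrite doubleS !addnS; apply: out_step.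
have [j le_ij fj] := won (inl x0) i.
(* At an even distance from [i], [x0] itself would lie outside [T]. At an odd distance, its
   predecessor in the play would also belong to [V0], against bipartiteness. *)
have := odd_double_half (j - i); case: (odd _) => [odd_j|even_j].
  have := play_f (i + (j - i)./2.*2).
  have -> : (i + (j - i)./2.*2).+1 = j by lia.
  have := out_from (j - i)./2.
  by case: (f (i + _)) => // x _ xx; case: (edge_owner xx); rewrite fj.
have := out_from (j - i)./2.
have -> : i + (j - i)./2.*2 = j by move: even_j; rewrite /=; lia.
by rewrite fj /= Tx0.
Qed.

End Games.

(** * Structured programs on the random-access machine *)

Inductive cmd :=
  | Block of seq instr
  | Seq of cmd & cmd
  | If of nat & cmd & cmd
  | While of nat & cmd.

(** Jumps of the machine are absolute, so the code depends on the address [l] at which it is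
    placed. *)
Fixpoint compile (l : nat) (c : cmd) : program :=
  match c with
  | Block ops => ops
  | Seq c1 c2 => let p1 := compile l c1 in p1 ++ compile (l + size p1) c2
  | If r c1 c2 =>
    let p1 := compile l.+1 c1 in
    let l2 := l + (size p1).+2 in
    let p2 := compile l2 c2 in
    IJumpZ r l2 :: p1 ++ IJump (l2 + size p2) :: p2
  | While r c1 =>
    let p1 := compile l.+1 c1 in
    IJumpZ r (l + (size p1).+2) :: p1 ++ [:: IJump l]
  end.

Definition state := ((nat -> nat) * (nat -> nat))%type.

Definition at_pc (l : nat) (s : state) : config := Config l s.1 s.2.

(** Convertible to the update in [exec]; written with [eqn] so that simplification evaluates it at
    numeral registers. *)
Definition upd (f : nat -> nat) (i k x : nat) : nat :=
  if eqn x i then k else f x.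
Arguments upd f !i k !x /.

Lemma upd_eq f i k : upd f i k i = k.
Proof. by rewrite /upd eqnE eqxx. Qed.

Lemma upd_neq f i k x : x != i -> upd f i k x = f x.
Proof. by rewrite /upd eqnE => /negPf->. Qed.

Definition effect (i : instr) (s : state) : state :=
  match i with
  | IConst i k => (upd s.1 i k, s.2)
  | IAdd i j k => (upd s.1 i (s.1 j + s.1 k), s.2)
  | ISub i j k => (upd s.1 i (s.1 j - s.1 k), s.2)
  | ILoad i j => (upd s.1 i (s.2 (s.1 j)), s.2)
  | IStore i j => (s.1, upd s.2 (s.1 i) (s.1 j))
  | _ => s
  end.

(* Jumps are excluded: they only arise from [compile]. *)
Definition safe (B : nat) (i : instr) (s : state) : bool :=
  match i with
  | IConst _ k => k <= B
  | IAdd _ j k => s.1 j + s.1 k <= B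
  | IJump _ | IJumpZ _ _ => false
  | _ => true
  end.

Fixpoint block_effect (ops : seq instr) (s : state) : state :=
  if ops is i :: ops' then block_effect ops' (effect i s) else s.

Fixpoint block_safe (B : nat) (ops : seq instr) (s : state) : Prop :=
  if ops is i :: ops' then safe B i s /\ block_safe B ops' (effect i s) else
    True.

Definition segment (p : program) (l : nat) (q : program) : Prop :=
  exists p1 p2, p = p1 ++ q ++ p2 /\ size p1 = l.

Definition reaches B p l s T l' (Q : state -> Prop) : Prop :=
  exists t s', [/\ t <= T, run p t (at_pc l s) = at_pc l' s', Q s'
    & forall t', t' <= t -> words_le B (run p t' (at_pc l s))].

Definition bounded B (s : state) := words_le B (at_pc 0 s).

Definition triple B (c : cmd) (s : state) (T : nat) (Q : state -> Prop) : Prop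
  :=
  forall p l, segment p l (compile l c) -> bounded B s ->
    reaches B p l s T (l + size (compile l c)) Q.

(** * Rules for triples with time and word bounds *)

Section Rules.
Variable B : nat.
Implicit Types (s : state) (Q : state -> Prop).

Lemma bounded_effect i s : safe B i s -> bounded B s -> bounded B (effect i s).
Proof.
case: s => r m safe_i bd.
have rB j : r j <= B by case: (bd j).
have mB j : m j <= B by case: (bd j).
case: i safe_i => [i k|i j k|i j k|i j|i j|//|//] /= safe_i x; split=> //=.
- by rewrite /upd; case: eqnP.
- by rewrite /upd; case: eqnP.
- by rewrite /upd; case: eqnP => // _; apply: leq_trans (leq_subr _ _) _.
- by rewrite /upd; case: eqnP.
- by rewrite /upd; case: eqnP.
Qed.

Lemma segment_onth p l q k : segment p l q -> k < size q ->
  onth p (l + k) = onth q k.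
Proof.
case=> p1 [p2 [-> <-]] lt_k.
by rewrite !onthE !map_cat nth_cat size_map ltnNge leq_addr /= addKn nth_cat
  size_map lt_k.
Qed.

Lemma segment_cat p l q1 q2 : segment p l (q1 ++ q2) ->
  segment p l q1 /\ segment p (l + size q1) q2.
Proof.
case=> p1 [p2 [-> <-]]; split.
  by exists p1, (q2 ++ p2); rewrite !catA.
by exists (p1 ++ q1), p2; rewrite !catA size_cat.
Qed.

Lemma segment_cons p l i q : segment p l (i :: q) ->
  onth p l = Some i /\ segment p l.+1 q.
Proof.
move=> sg; split; first by rewrite -[l]addn0 (segment_onth sg).
by case: (@segment_cat p l [:: i] q sg) => _; rewrite addn1.
Qed.

Lemma runS p t c : run p t.+1 c = run p t (step p c).
Proof. by rewrite /run iterSr. Qed.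

Lemma reaches_refl p l s Q : bounded B s -> Q s -> reaches B p l s 0 l Q.
Proof.
by move=> bd Qs; exists 0, s; split=> // t'; rewrite leqn0 => /eqP->.
Qed.

Lemma reaches_step p l s l1 s1 T l' Q :
  step p (at_pc l s) = at_pc l1 s1 -> bounded B s ->
  reaches B p l1 s1 T l' Q -> reaches B p l s T.+1 l' Q.
Proof.
move=> st bd [t [s' [le_t rn Qs' bds]]]; exists t.+1, s'.
split=> //; first by rewrite runS st.
case=> [_|t' lt_t']; first exact: bd.
by rewrite runS st; apply: bds.
Qed.

Lemma reaches_trans p l s T1 l1 Q1 T2 l2 Q2 :
  reaches B p l s T1 l1 Q1 ->
  (forall s1, bounded B s1 -> Q1 s1 -> reaches B p l1 s1 T2 l2 Q2) ->
  reaches B p l s (T1 + T2) l2 Q2.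
Proof.
case=> [t1 [s1 [le1 rn1 Q1s1 bd1]]] next.
have bds1 : bounded B s1 by have := bd1 t1 (leqnn _); rewrite rn1.
have [t2 [s2 [le2 rn2 Q2s2 bd2]]] := next s1 bds1 Q1s1.
exists (t1 + t2), s2; split=> //; first exact: leq_add.
  by rewrite /run addnC iterD -/(run p t1 _) rn1.
move=> t' le_t'; have [/bd1//|lt_t'] := leqP t' t1.
have -> : t' = (t' - t1) + t1 by rewrite subnK // ltnW.
by rewrite /run iterD -/(run p t1 _) rn1; apply: bd2; rewrite leq_subLR.
Qed.

Lemma reaches_leq p l s T T' l' Q : T <= T' ->
  reaches B p l s T l' Q -> reaches B p l s T' l' Q.
Proof.
by move=> le_T [t [s' [le_t *]]]; exists t, s'; split=> //;
  apply: leq_trans le_T.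
Qed.

Lemma step_safe p l i s : onth p l = Some i -> safe B i s ->
  step p (at_pc l s) = at_pc l.+1 (effect i s).
Proof. by rewrite /step /= => ->; case: s; case: i. Qed.

Lemma triple_conseq c s T T' (Q Q' : state -> Prop) : triple B c s T Q ->
  T <= T' -> (forall s', Q s' -> Q' s') -> triple B c s T' Q'.
Proof.
move=> tr le_T QQ' p l sg bd.
have [t [s' [le_t rn Qs' bds]]] := tr p l sg bd.
by exists t, s'; split=> //; [apply: leq_trans le_T | apply: QQ'].
Qed.

Lemma triple_leq c s T T' Q : triple B c s T Q -> T <= T' -> triple B c s T' Q.
Proof. by move=> tr le_T; apply: triple_conseq tr le_T _. Qed.

Lemma triple_block ops s T Q : block_safe B ops s -> size ops <= T ->
  Q (block_effect ops s) -> triple B (Block ops) s T Q.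
Proof.
move=> sf le_T Qs p l /= sg bd; apply: reaches_leq le_T _.
elim: ops l s sf Qs sg bd => [|i ops IHops] l s /=.
  by move=> _ Qs _ bd; rewrite addn0; apply: reaches_refl.
case=> safe_i sf Qs /segment_cons[get_i sg] bd.
rewrite addnS -addSn; apply: (reaches_step (step_safe get_i safe_i) bd).
by apply: IHops => //; apply: bounded_effect.
Qed.

Lemma triple_seq c1 c2 s T1 T2 Q1 Q : triple B c1 s T1 Q1 ->
  (forall s1, Q1 s1 -> triple B c2 s1 T2 Q) ->
  triple B (Seq c1 c2) s (T1 + T2) Q.
Proof.
move=> tr1 tr2 p l /= /segment_cat[sg1 sg2] bd.
rewrite size_cat addnA; apply: (reaches_trans (tr1 p l sg1 bd)).
by move=> s1 bd1 /tr2 tr; apply: tr.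
Qed.

(** The two extra steps are the test and, after the first branch, the jump over the second. *)
Lemma triple_if r c1 c2 s T Q :
  (s.1 r != 0 -> triple B c1 s T Q) -> (s.1 r = 0 -> triple B c2 s T Q) ->
  triple B (If r c1 c2) s T.+2 Q.
Proof.
move=> tr1 tr2 p l /= /segment_cons[get_j sg] bd.
have [sg1 /segment_cons[get_e sg2]] := segment_cat sg.
have [r0|rN0] := eqVneq (s.1 r) 0.
  apply: (@reaches_leq _ _ _ T.+1) => //; apply: (reaches_step _ bd).
    by rewrite /step /= get_j /= r0 eqxx.
  have -> : l + (size (compile l.+1 c1 ++ IJump (l + (size (compile l.+1 c1)).+2
    + size (compile (l + (size (compile l.+1 c1)).+2) c2)) ::
    compile (l + (size (compile l.+1 c1)).+2) c2)).+1 =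
    l + (size (compile l.+1 c1)).+2
    + size (compile (l + (size (compile l.+1 c1)).+2) c2).
    by rewrite size_cat /=; lia.
  by apply: (tr2 r0) bd; move: sg2; rewrite addSnnS -addnS.
apply: (reaches_step _ bd); first by rewrite /step /= get_j /= (negPf rN0).
apply: (@reaches_leq _ _ _ (T + 1)); first by rewrite addn1.
apply: (reaches_trans (tr1 rN0 _ _ sg1 bd)) => s1 bd1 Qs1.
apply: (reaches_step _ bd1 (reaches_refl _ _ bd1 Qs1)).
move: get_e; rewrite /step /= => -> /=; rewrite /at_pc; congr Config.
by rewrite size_cat /=; lia.
Qed.

(* [k] bounds the number of iterations that remain. *)
Lemma triple_while r c (I : nat -> state -> Prop) T k s :
  (forall k s, I k s -> s.1 r != 0 ->
     exists2 k', k = k'.+1 & triple B c s T (I k')) ->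
  I k s ->
  triple B (While r c) s (k * T.+2).+1
    (fun s' => s'.1 r = 0 /\ exists k', I k' s').
Proof.
move=> body Ik p l /= sg bd.
have := sg => /segment_cons[get_j sg'].
have [sg1 /segment_cons[get_e _]] := segment_cat sg'.
elim/ltn_ind: k s Ik bd => k IHk s Ik bd.
have [r0|rN0] := eqVneq (s.1 r) 0.
  apply: (@reaches_leq _ _ _ 1) => //; apply: (reaches_step _ bd).
    by rewrite /step /= get_j /= r0 eqxx.
  rewrite size_cat /= addn1; apply: reaches_refl => //.
  by split=> //; exists k.
have [k' def_k tr] := body _ _ Ik rN0.
apply: (@reaches_leq _ _ _ (T + (k' * T.+2).+2).+1); first by rewrite def_k;
  lia.
apply: (reaches_step _ bd); first by rewrite /step /= get_j /= (negPf rN0).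
apply: (reaches_trans (tr _ _ sg1 bd)) => s1 bd1 Is1.
apply: (reaches_step _ bd1); first by move: get_e; rewrite /step /= => ->.
by apply: IHk => //; rewrite def_k.
Qed.

(** Meant for loop-free code, whose cost is read off the syntax; [False] at [While] leaves loops to
    the invariant rules. *)
Fixpoint wp (c : cmd) s Q : Prop :=
  match c with
  | Block ops => block_safe B ops s /\ Q (block_effect ops s)
  | Seq c1 c2 => wp c1 s (fun s1 => wp c2 s1 Q)
  | If r c1 c2 => (s.1 r != 0 -> wp c1 s Q) /\ (s.1 r = 0 -> wp c2 s Q)
  | While _ _ => False
  end.

Fixpoint cost (c : cmd) : nat :=
  match c with
  | Block ops => size ops
  | Seq c1 c2 => cost c1 + cost c2
  | If _ c1 c2 => (maxn (cost c1) (cost c2)).+2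
  | While _ _ => 0
  end.

Lemma triple_wp c s Q : wp c s Q -> triple B c s (cost c) Q.
Proof.
elim: c s Q => [ops|c1 IH1 c2 IH2|r c1 IH1 c2 IH2|//] s Q /=.
- by case=> sf Qs; apply: triple_block.
- by move/IH1 => tr; apply: triple_seq tr _ => s1 /IH2.
- case=> w1 w2; apply: triple_if => [/w1/IH1|/w2/IH2] tr.
    by apply: triple_conseq tr _ _; rewrite ?leq_maxl.
  by apply: triple_conseq tr _ _; rewrite ?leq_maxr.
Qed.

(** The register [r] holds the exact number of iterations left, so leaving the loop with [r] zero
    means [I 0]. *)
Lemma triple_for r c (I : nat -> state -> Prop) k s :
  (forall k s, I k s -> s.1 r = k) ->
  (forall k s, I k.+1 s -> wp c s (I k)) ->
  I k s -> triple B (While r c) s (k * (cost c).+2).+1 (I 0).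
Proof.
move=> counter body Ik.
have step_I j s1 : I j s1 -> s1.1 r != 0 ->
    exists2 j', j = j'.+1 & triple B c s1 (cost c) (I j').
  move=> Ij; rewrite (counter _ _ Ij); case: j Ij => // j Ij _.
  by exists j => //; apply: triple_wp; apply: body.
apply: triple_conseq (triple_while step_I Ik) (leqnn _) _ => s' [r0 [j Ij]].
by move: r0; rewrite (counter _ _ Ij) => j0; rewrite -j0.
Qed.

(** Halting is running off the end of the code, after which the configuration never changes; hence
    the word bound extends to all times. *)
Lemma triple_sound c s T Q : bounded B s -> triple B c s T Q ->
  exists t s', [/\ t <= T, halted (compile 0 c) (run (compile 0 c) t (at_pc 0
    s)),
    Q s', run (compile 0 c) t (at_pc 0 s) = at_pc (size (compile 0 c)) s'
  & forall t', words_le B (run (compile 0 c) t' (at_pc 0 s))].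
Proof.
move=> bd tr; have [|t [s' [le_t rn Qs' bds]]] := tr (compile 0 c) 0 _ bd.
  by exists [::], [::]; rewrite cats0.
exists t, s'; split=> //; first by rewrite /halted rn /= add0n.
move=> t'; have [/bds//|lt_t] := leqP t' t.
have halt k : run (compile 0 c) k (at_pc (size (compile 0 c)) s')
              = at_pc (size (compile 0 c)) s'.
  by elim: k => // k IHk; rewrite runS /step /= onth_default.
rewrite -(subnK (ltnW lt_t)) /run iterD -/(run _ t _) rn.
by rewrite -/(run _ _ _) halt -rn; apply: bds.
Qed.

End Rules.

(** * Loops of the solver *)

(* Registers: 0 and 1 hold these constants, 2 |V0|, 3 |V|, 4 the length
   L = 2 |V| + 1 of a row, 5 the base address D behind the input, 6 2 |V|, 7 the
   row of the top class, 8 the number of merges still needed, 9 the answer, 10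
   whether to continue; the others are temporary.
   Memory: from D on, a row of totals, then one row for each vertex of [V0].
   Slots |V0|, ..., |V| - 1 of a row count the edges from each vertex of [V1]
   into the class, slots |V| + |V0|, ..., 2 |V| - 1 those out of the class, and
   the last slot is the stack link.  The free slots 0, ..., |V0| - 1 of the row
   of totals hold the addresses of the other rows, as the machine cannot
   multiply. *)

Local Notation skip := (Block [::]).

Definition read_header : cmd := Block
  [:: IConst 1 1; ILoad 2 0; ILoad 11 1; IAdd 3 2 11; IAdd 6 3 3; IAdd 4 6 1;
      IConst 12 2; ILoad 12 12; IConst 5 3; IAdd 5 5 12; IAdd 5 5 12].

Definition row_pointers : cmd :=
  Seq (Block [:: IAdd 11 2 0; IAdd 14 5 0; IAdd 15 5 0])
  (While 11 (Block
    [:: IAdd 14 14 4; IStore 15 14; IAdd 15 15 1; ISub 11 11 1])).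

Definition load_edges : cmd :=
  Seq (Block [:: IAdd 11 12 0; IConst 14 3])
  (While 11
    (Seq (Block [:: ILoad 15 14; IAdd 14 14 1; ILoad 16 14; IAdd 14 14 1;
                    ISub 11 11 1; ISub 17 2 15])
    (Seq (If 17 (Block [:: IAdd 18 5 15; ILoad 18 18; IAdd 19 3 16])
                (Block [:: IAdd 18 5 16; ILoad 18 18; IAdd 19 15 0]))
      (Block [:: IAdd 18 18 19; ILoad 20 18; IAdd 20 20 1; IStore 18 20;
                 IAdd 18 5 19; ILoad 20 18; IAdd 20 20 1; IStore 18 20])))).

Definition check_degrees : cmd :=
  Seq (Block [:: IConst 10 1; ISub 11 3 2; IAdd 14 5 2])
  (Seq (If 2 skip (Block [:: IConst 10 0]))
  (Seq (If 11 skip (Block [:: IConst 10 0]))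
  (While 11
    (Seq (Block [:: ILoad 15 14; IAdd 16 14 3; ILoad 16 16])
    (Seq (If 15 skip (Block [:: IConst 10 0]))
    (Seq (If 16 skip (Block [:: IConst 10 0]))
    (Block [:: IAdd 14 14 1; ISub 11 11 1]))))))).

Definition find_pivot : cmd :=
  Seq (Block [:: IConst 12 0; IAdd 16 2 0; ISub 11 3 16])
  (While 11
    (Seq (Block [:: IAdd 14 7 16; IAdd 15 5 16; ILoad 17 14; ILoad 18 15;
                    ISub 17 18 17; IAdd 14 14 3; IAdd 15 15 3;
                    ILoad 18 14; ILoad 19 15; ISub 18 19 18])
    (Seq (If 17 skip (If 18 (Block [:: IAdd 12 16 0]) skip))
    (Block [:: IAdd 16 16 1; ISub 11 3 16])))).

(** Register 15 receives the distance between registers 14 and 7 as a sum of two truncated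
    differences, so it vanishes exactly at the row of the top class. *)
Definition find_class : cmd :=
  Seq (Block [:: IConst 13 0; IAdd 14 5 0; IAdd 11 2 0])
  (While 11
    (Seq (Block [:: IAdd 14 14 4; ISub 11 11 1; ISub 15 14 7; ISub 16 7 14;
                    IAdd 15 15 16; IAdd 16 14 3; IAdd 16 16 12; ILoad 16 16])
    (If 15 (If 16 (Block [:: IAdd 13 14 0]) skip) skip))).

(** The loop stops just before offset [2 |V|], where the link is stored, so that links survive a
    merge. *)
Definition merge_rows : cmd :=
  Seq (Block [:: IConst 16 0; IAdd 11 6 0])
  (While 11 (Block
    [:: IAdd 14 13 16; IAdd 15 7 16; ILoad 17 14; ILoad 18 15; IAdd 17 17 18;
        IStore 14 17; IStore 15 0; IAdd 16 16 1; ISub 11 6 16])).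

Definition fill (i : nat) : cmd :=
  Seq (Block [:: IAdd 11 3 0])
  (While 11 (Block [:: IStore 14 i; IAdd 14 14 1; ISub 11 11 1])).

(** * Correctness and cost of the loops *)

Section Specs.
Variables (B n0 n1 n L D : nat).
Hypotheses (def_n : n = n0 + n1) (def_L : L = n + n + 1).
(** The rows fill [n0 + 1] lengths; one more is reserved because [solve] touches the row at [D + L]
    even when [n0 = 0]. *)
Hypothesis leB : D + (n0 + 2) * L <= B.

Record globals (r : nat -> nat) : Prop := Globals {
  reg0 : r 0 = 0; reg1 : r 1 = 1; reg2 : r 2 = n0; reg3 : r 3 = n;
  reg4 : r 4 = L; reg5 : r 5 = D; reg6 : r 6 = n + n }.

Definition same_regs k (r r' : nat -> nat) := forall i, i < k -> r' i = r i.

Lemma same_upd k r r' i v : k <= i -> same_regs k r r' -> same_regs k r (upd r'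
  i v).
Proof.
move=> le_ki same j lt_j; rewrite /upd eqnE ifN ?same //.
by apply: contraTneq lt_j => ->; rewrite -leqNgt.
Qed.

Lemma same_globals k r r' : same_regs k r r' -> 6 < k -> globals r -> globals
  r'.
Proof.
move=> same lt6 [g0 g1 g2 g3 g4 g5 g6].
by split; rewrite same //; apply: leq_trans lt6.
Qed.

Lemma row_le u : u < n0 -> D + u.+1 * L + L <= B.
Proof.
move=> lt_u; apply: leq_trans leB; rewrite -addnA leq_add2l -mulSnr leq_mul2r.
by rewrite addn2 !ltnS (ltnW lt_u) orbT.
Qed.

Lemma row_pointers_spec r m : globals r ->
  triple B row_pointers (r, m) (10 * n0 + 4) (fun s' =>
    [/\ same_regs 11 r s'.1, s'.1 12 = r 12
      & forall a, s'.2 a = if D <= a < D + n0 then D + (a - D).+1 * L else m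
        a]).
Proof.
move=> g; have := leB; have mulL : (n0 + 2) * L = n0 * L + L + L by lia.
move=> leB'.
apply: (@triple_leq _ _ _ (3 + (n0 * 6).+1)); last by lia.
pose I k (s : state) := [/\ same_regs 11 r s.1, s.1 12 = r 12, s.1 11 = k /\ k
  <= n0,
  s.1 14 = D + (n0 - k) * L /\ s.1 15 = D + (n0 - k)
  & forall a, s.2 a = if D <= a < D + (n0 - k) then D + (a - D).+1 * L else m
    a].
apply: (@triple_seq _ _ _ _ _ _ (I n0)).
  apply: triple_wp; rewrite /= !(reg0 g) (reg2 g) (reg5 g) !addn0.
  split; first by do !split; lia.
  split=> //=; last by move=> a; rewrite subnn addn0; case: ltngtP.
  - by do !apply: same_upd => //.
  - by rewrite subnn mul0n !addn0.
move=> s1 I1; apply: triple_conseq (triple_for (I := I) _ _ I1) (leqnn _) _.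
- by move=> k s [_ _ []].
- move=> k [r' m'] [/= same r12 [r11 le_k] [r14 r15] mE].
  have lt_k : (n0 - k) * L = (n0 - k.+1) * L + L by rewrite -mulSnr;
    congr (_ * _); lia.
  have g' := same_globals same isT g; rewrite (reg1 g') (reg4 g') r11 r14 r15.
  have : (n0 - k) * L <= n0 * L by rewrite leq_mul2r leq_subr orbT.
  split; first by do !split; lia.
  split=> //=.
  + by do !apply: same_upd => //.
  + by lia.
  + by rewrite lt_k; lia.
  + move=> a; rewrite /upd; case: eqnP => [->|neq].
      rewrite ifT; last by lia.
      by rewrite -addnA -lt_k; congr (_ + _ * _); lia.
    by rewrite mE; congr (if _ then _ else _); lia.
- by case=> r' m' [same r12 _ _ mE]; split=> // a; rewrite mE subn0.
Qed.

Definition slot (e : nat * nat) := if e.1 < n0 then n + e.2 else e.1.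
Definition row (e : nat * nat) :=
  D + (if e.1 < n0 then e.1 else e.2).+1 * L.
(** Each edge is counted twice, in the row of its end in [V0] and in the row of totals. *)
Definition load (es : seq (nat * nat)) a :=
  count (fun e => row e + slot e == a) es + count (fun e => D + slot e == a) es.

Definition bipartite_code (e : nat * nat) :=
  (e.1 < n0) && (n0 <= e.2 < n) || (e.2 < n0) && (n0 <= e.1 < n).

Lemma slot_bounds e : bipartite_code e -> n0 <= slot e < n + n.
Proof. by rewrite /bipartite_code /slot; case: ltnP; lia. Qed.

Lemma row_bounds e : bipartite_code e -> D + L <= row e /\ row e + L <= B.
Proof.
rewrite /bipartite_code /row => e_ok; split.
  by rewrite leq_add2l mulSnr leq_addl.
by apply: row_le; move: e_ok; case: ltnP; lia.
Qed.

(** The loading loop reads edges and row addresses from the memory that it modifies. Slots are at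
    least [n0], so its writes stay beyond both. *)
Lemma load_pointers es a : all bipartite_code es -> a < D + n0 -> load es a = 0.
Proof.
move=> es_ok lt_a; have no_cell (p : pred (nat * nat)) :
    (forall e, bipartite_code e -> ~~ p e) -> count p es = 0.
  move=> np; rewrite (@eq_in_count _ p pred0) ?count_pred0 // => e es_e.
  by apply: negbTE; apply: np; apply: (allP es_ok).
by rewrite /load !no_cell // => e e_ok; have := slot_bounds e_ok;
  have := row_bounds e_ok; lia.
Qed.

Lemma load_rcons es e a : load (rcons es e) a =
  load es a + (row e + slot e == a) + (D + slot e == a).
Proof. by rewrite /load -!cats1 !count_cat /= !addn0; lia. Qed.

Lemma load_le es a : load es a <= size es + size es.
Proof. by apply: leq_add; apply: count_size. Qed.

Lemma load_edges_spec r m es : globals r -> r 12 = size es ->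
  D = 3 + size es + size es ->
  all bipartite_code es ->
  (forall i, i < size es -> m (3 + i + i) = (nth (0, 0) es i).1) ->
  (forall i, i < size es -> m (4 + i + i) = (nth (0, 0) es i).2) ->
  (forall u, u < n0 -> m (D + u) = D + u.+1 * L) ->
  (forall a, D + n0 <= a -> m a = 0) ->
  triple B load_edges (r, m) (25 * size es + 3) (fun s' =>
    same_regs 11 r s'.1 /\ forall a, s'.2 a = m a + load es a).
Proof.
move=> g r12 def_D es_ok m1 m2 m_ptr m0.
have leD : D + 2 * L <= B.
  by apply: leq_trans leB; rewrite leq_add2l leq_mul2r leq_addl orbT.
pose I k (s : state) := [/\ same_regs 11 r s.1, s.1 11 = k /\ k <= size es,
  s.1 14 = 3 + (size es - k) + (size es - k)
  & forall a, s.2 a = m a + load (take (size es - k) es) a].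
apply: (@triple_leq _ _ _ (2 + (size es * 21).+1)); last by lia.
apply: (@triple_seq _ _ _ _ _ _ (I (size es))).
  apply: triple_wp; rewrite /= (reg0 g) r12 !addn0.
  split; first by do !split; lia.
  split=> //=; rewrite ?subnn ?addn0 //.
  - by do !apply: same_upd => //.
  - by move=> a; rewrite take0 addn0.
move=> s1 I1; apply: triple_conseq (triple_for (I := I) _ _ I1) (leqnn _) _.
- by move=> k s [_ []].
- move=> k [r' m'] Is; rewrite /I /= in Is; case: Is => same [r11 le_k] r14 mE.
  have g' := same_globals same isT g.
  set i := size es - k.+1 in r14 mE.
  have lt_i : i < size es by rewrite /i; lia.
  have iS : size es - k = i.+1 by rewrite /i; lia.
  set e := nth (0, 0) es i.
  have e_ok : bipartite_code e by apply: (allP es_ok); apply: mem_nth.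
  have take_ok : all bipartite_code (take i es).
    by apply/allP => x /mem_take; apply: (allP es_ok).
  have m'ptr a : a < D + n0 -> m' a = m a.
    by move=> lt_a; rewrite mE load_pointers ?addn0.
  have m'1 : m' (3 + i + i) = e.1 by rewrite m'ptr ?m1 //; lia.
  have m'2 : m' (3 + i + i + 1) = e.2.
    by rewrite m'ptr ?addn1 -?m2 //; lia.
  have sl := slot_bounds e_ok; have [rw1 rw2] := row_bounds e_ok.
  have m'le a : D + n0 <= a -> m' a <= i + i.
    move=> le_a; rewrite mE m0 // (leq_trans (load_le _ _)) //.
    by rewrite size_take lt_i.
  have rowE : row e = m' (D + (if e.1 < n0 then e.1 else e.2)).
    have lt_u : (if e.1 < n0 then e.1 else e.2) < n0.
      by move: e_ok; rewrite /bipartite_code; case: ltnP; lia.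
    by rewrite m'ptr ?m_ptr // ltn_add2l.
  have final : forall r1, same_regs 11 r r1 -> r1 11 = k -> r1 14 = 5 + i + i ->
      r1 18 = row e -> r1 19 = slot e ->
      wp B (Block [:: IAdd 18 18 19; ILoad 20 18; IAdd 20 20 1; IStore 18 20;
                 IAdd 18 5 19; ILoad 20 18; IAdd 20 20 1; IStore 18 20])
        (r1, m') (I k).
    move=> r1 same1 r11' r14' r18 r19; have g1 := same_globals same1 isT g.
    rewrite /= r18 r19 (reg1 g1) (reg5 g1).
    (* The two increments hit different cells, as [row e] lies at least one row beyond [D]; the
       second load is thus undisturbed by the first store. *)
    have neq : D + slot e != row e + slot e by lia.
    have le1 := m'le (row e + slot e); have le2 := m'le (D + slot e).
    split; first by rewrite upd_neq //; do !split; lia.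
    split=> //=.
    + by do !apply: same_upd => //.
    + by lia.
    + by rewrite iS; lia.
    + move=> a; rewrite iS (take_nth (0, 0)) // load_rcons -/e addnA addnA -mE.
      rewrite [upd m' _ _ (D + _)]upd_neq //.
      have [<-|neq_r] := eqVneq (row e + slot e) a.
        by rewrite upd_neq 1?eq_sym // upd_eq eq_sym (negPf neq) addn0.
      have [<-|neq_t] := eqVneq (D + slot e) a; first by rewrite upd_eq ?addn0.
      by rewrite !upd_neq 1?eq_sym // !addn0.
  split; first by rewrite /= (reg1 g') r14; do !split; lia.
  rewrite [block_effect _ _]/= r14 (reg1 g') m'1 m'2 (reg2 g') r11.
  set r1 := (X in (X, m')).
  have same1 : same_regs 11 r r1 by do !apply: same_upd => //.
  have g1 := same_globals same1 isT g.
  have [q14 [q15 [q16 [q17 q11]]]] : r1 14 = 5 + i + i /\ r1 15 = e.1 /\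
    r1 16 = e.2 /\ r1 17 = n0 - e.1 /\ r1 11 = k by rewrite /r1 /=; do !split;
      lia.
  clearbody r1; rewrite /bipartite_code in e_ok; split.
    rewrite [X in X != 0]q17 => lt_e; have lt : e.1 < n0 by lia.
    split; first by rewrite /= (reg5 g1) (reg3 g1) q15 q16; do !split; lia.
    apply: final => //=; first by do !apply: same_upd => //.
    + by rewrite rowE lt (reg5 g1) q15.
    + by rewrite /slot lt (reg3 g1) q16.
  rewrite [X in X = 0]q17 => ge_e; have lt : (e.1 < n0) = false by lia.
  split; first by rewrite /= (reg5 g1) (reg0 g1) q15 q16; do !split; lia.
  apply: final => //=; first by do !apply: same_upd => //.
  + by rewrite rowE lt (reg5 g1) q16.
  + by rewrite /slot lt (reg0 g1) q15 addn0.
- case=> r' m' [same _ _ mE]; split=> // a.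
  by rewrite mE subn0 take_size.
Qed.

Definition degrees_ok (m : nat -> nat) :=
  [&& 0 < n0, 0 < n1
    & all (fun w => (m (D + w) != 0) && (m (D + (n + w)) != 0)) (iota n0 n1)].

Lemma check_degrees_spec r m : globals r ->
  triple B check_degrees (r, m) (20 * n + 20) (fun s' =>
    [/\ same_regs 7 r s'.1, s'.2 = m & s'.1 10 = degrees_ok m]).
Proof.
move=> g; have leD : D + 2 * L <= B.
  by apply: leq_trans leB; rewrite leq_add2l leq_mul2r leq_addl orbT.
set P := fun w => (m (D + w) != 0) && (m (D + (n + w)) != 0).
pose I k (s : state) := [/\ same_regs 7 r s.1, s.1 11 = k /\ k <= n1,
  s.2 = m, s.1 14 = D + n0 + (n1 - k)
  & s.1 10 = [&& 0 < n0, 0 < n1 & all P (iota n0 (n1 - k))] :> nat].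
pose J (b : bool) (s : state) := [/\ same_regs 7 r s.1, s.1 11 = n1, s.2 = m,
  s.1 14 = D + n0 & s.1 10 = b].
apply: (@triple_leq _ _ _ (3 + (3 + (3 + (n1 * 13).+1)))); last by lia.
apply: (@triple_seq _ _ _ _ _ _ (J true)).
  apply: triple_wp; rewrite /= (reg3 g) (reg2 g) (reg5 g).
  split; first by do !split; lia.
  by split=> //=; [do !apply: same_upd => //|lia].
move=> [r1 m1] [/= same1 r11 -> r14 r10].
apply: (@triple_seq _ _ _ _ _ _ (J (0 < n0))).
  apply: (@triple_wp _ (If 2 skip (Block [:: IConst 10 0]))) => /=.
  rewrite same1 // (reg2 g).
  split=> [n0N|n0_0]; first by split=> //; split=> //=; rewrite r10 lt0n n0N.
  by split=> //; split=> //=; [do !apply: same_upd => //|rewrite n0_0].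
move=> [{}r1 {}m1] [/= {}same1 {}r11 -> {}r14 {}r10].
apply: (@triple_seq _ _ _ _ _ _ (I n1)).
  apply: (@triple_wp _ (If 11 skip (Block [:: IConst 10 0]))) => /=.
  rewrite r11 /I subnn addn0 /= andbT.
  split=> [n1N|n1_0]; first by split=> //; split=> //=;
    rewrite r10 [0 < n1]lt0n n1N andbT.
  split=> //; split=> //=; first by do !apply: same_upd => //.
  by rewrite n1_0 andbF.
move=> s1 I1; apply: triple_conseq (triple_for (I := I) _ _ I1) (leqnn _) _.
- by move=> k s [_ []].
- move=> k [r' m'] Is; rewrite /I /= in Is.
  case: Is => {same1}same [{}r11 le_k] -> {}r14 {}r10.
  have g' := same_globals same isT g.
  set w := n1 - k.+1 in r14 r10.
  have wS : n1 - k = w + 1 by rewrite /w; lia.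
  have allS : [&& 0 < n0, 0 < n1 & all P (iota n0 (n1 - k))] =
      [&& 0 < n0, 0 < n1 & all P (iota n0 w)] && P (n0 + w).
    by rewrite wS iotaD all_cat /= andbT !andbA.
  have next (r2 : nat -> nat) : same_regs 7 r r2 -> r2 11 = k.+1 ->
      r2 14 = D + n0 + w ->
      r2 10 = [&& 0 < n0, 0 < n1 & all P (iota n0 w)] && P (n0 + w) ->
      wp B (Block [:: IAdd 14 14 1; ISub 11 11 1]) (r2, m) (I k).
    move=> same2 q11 q14 q10; have g2 := same_globals same2 isT g.
    rewrite /= q14 q11 (reg1 g2); split; first by rewrite /w; do !split; lia.
    split=> //=; [by do !apply: same_upd => //|by lia|by rewrite wS addnA|].
    by rewrite allS.
  split; first by rewrite /= r14 (reg3 g'); rewrite /w; do !split; lia.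
  rewrite [block_effect _ _]/= r14 (reg3 g').
  set r1' := (X in (X, m)).
  have {}same1 : same_regs 7 r r1' by do !apply: same_upd => //.
  have [q10 [q11 [q14 [q15 q16]]]] : r1' 10 = r' 10 /\ r1' 11 = k.+1 /\
    r1' 14 = D + n0 + w /\ r1' 15 = m (D + n0 + w) /\ r1' 16 = m (D + n0 + w +
      n).
    by rewrite /r1' /=; do !split; lia.
  have PE : P (n0 + w) = (r1' 15 != 0) && (r1' 16 != 0).
    by rewrite /P q15 q16 [n + _]addnC !addnA.
  rewrite r10 in q10.
  clearbody r1'; split=> /= [q15N0|q15_0]; split=> //; split=> [q16N0|q16_0];
    split=> //.
  + by apply: next; rewrite // q10 PE q15N0 q16N0 !andbT.
  + apply: next => //=; first by do !apply: same_upd => //.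
    by rewrite PE q16_0 !andbF.
  + apply: next => //=; first by do !apply: same_upd => //.
    by rewrite PE q15_0 /= andbF.
  + apply: next => //=; first by do !apply: same_upd => //.
    by rewrite PE q15_0 /= andbF.
- by case=> r' m' [same _ mE _]; rewrite subn0.
Qed.

(** Totals minus the row at [t] count the edges at [w] whose other end is outside the class: none
    may leave [w], some must enter it. *)
Definition is_pivot (m : nat -> nat) t w :=
  (m (D + w) - m (t + w) == 0) && (m (D + (n + w)) - m (t + (n + w)) != 0).

(** Zero in register 12 encodes failure. Codes of vertices in [V1] are at least [n0], so this is
    unambiguous once the degree check has ensured [0 < n0]. *)
Lemma find_pivot_spec r m t : globals r -> r 7 = t -> t + L <= B ->
  triple B find_pivot (r, m) (25 * n + 20) (fun s' =>
    [/\ same_regs 11 r s'.1, s'.2 = m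
      & (s'.1 12 = 0 /\ forall w, n0 <= w < n -> ~~ is_pivot m t w) \/
        (n0 <= s'.1 12 < n /\ is_pivot m t (s'.1 12))]).
Proof.
move=> g r7 le_t; set good := is_pivot m t; have leD : D + 2 * L <= B.
  by apply: leq_trans leB; rewrite leq_add2l leq_mul2r leq_addl orbT.
pose I k (s : state) := [/\ same_regs 11 r s.1, s.1 11 = k /\ k <= n1,
  s.2 = m, s.1 16 = n - k
  & (s.1 12 = 0 /\ forall w, n0 <= w < n - k -> ~~ good w) \/
    (n0 <= s.1 12 < n /\ good (s.1 12))].
apply: (@triple_leq _ _ _ (3 + (n1 * 19).+1)); last by lia.
apply: (@triple_seq _ _ _ _ _ _ (I n1)).
  apply: triple_wp; rewrite /= (reg0 g) (reg2 g) (reg3 g).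
  split; first by do !split; lia.
  split=> //=; try by lia.
  - by do !apply: same_upd => //.
  - by left; split=> // w; lia.
move=> s1 I1; apply: triple_conseq (triple_for (I := I) _ _ I1) (leqnn _) _.
- by move=> k s [_ []].
- move=> k [r' m'] Is; rewrite /I /= in Is.
  case: Is => same [r11 le_k] -> r16 found.
  have g' := same_globals same isT g.
  have r7' : r' 7 = t by rewrite same.
  set w := n - k.+1 in r16 found.
  have lt_w : n0 <= w < n by rewrite /w; lia.
  have done12 (r2 : nat -> nat) : same_regs 11 r r2 -> r2 16 = w ->
      (r2 12 = 0 /\ (forall v, n0 <= v <= w -> ~~ good v)) \/
        (n0 <= r2 12 < n /\ good (r2 12)) ->
      wp B (Block [:: IAdd 16 16 1; ISub 11 3 16]) (r2, m) (I k).
    move=> same2 q16 found2; have g2 := same_globals same2 isT g.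
    rewrite /= q16 (reg1 g2) (reg3 g2); split; first by do !split; lia.
    split=> //=; try by rewrite /w; lia.
    + by do !apply: same_upd => //.
    + case: found2 => [[q12 no]|]; [left; split=> // v lt_v|by right].
      by apply: no; move: lt_v; rewrite /w; lia.
  split.
    rewrite /= r7' r16 (reg5 g') (reg3 g'); do !split; try lia.
  rewrite [block_effect _ _]/= r7' r16 (reg5 g') (reg3 g').
  set r1 := (X in (X, m)).
  have same1 : same_regs 11 r r1 by do !apply: same_upd => //.
  have [q12 [q16 [q17 q18]]] : r1 12 = r' 12 /\ r1 16 = w /\
    r1 17 = m (D + w) - m (t + w) /\
    r1 18 = m (D + w + n) - m (t + w + n) by rewrite /r1 /=; do !split; lia.
  have goodE : good w = (r1 17 == 0) && (r1 18 != 0).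
    by rewrite q17 q18 /good /is_pivot ![n + w]addnC !addnA.
  have bad : ~~ good w -> wp B (Block [:: IAdd 16 16 1;
    ISub 11 3 16]) (r1, m) (I k).
    move=> bad_w; apply: done12; rewrite // q12.
    case: found => [[-> no]|]; [left; split=> // v le_v|by right].
    have [->//|neq_v] := eqVneq v w; apply: no; lia.
  clearbody r1; split=> [q17N0|q17_0].
    by split=> //; apply: bad; rewrite goodE (negPf q17N0).
  split=> [q18N0|q18_0].
    split; first by rewrite /= q16 (reg0 (same_globals same1 isT g));
      do !split; lia.
    apply: done12 => //=; first by do !apply: same_upd => //.
    right; rewrite q16 (reg0 (same_globals same1 isT g)) addn0 lt_w goodE.
    by rewrite [r1 17]q17_0 q18N0.
  by split=> //; apply: bad; rewrite goodE [r1 18]q18_0 andbF.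
- by case=> r' m' [same _ mE _]; rewrite subn0.
Qed.

(** Every row is a candidate, not only those of representatives: when [represents] holds for an
    idempotent [cl], the row of any other vertex is zero and fails the second test. *)
Definition is_pred (m : nat -> nat) t w u :=
  (D + u.+1 * L != t) && (m (D + u.+1 * L + (n + w)) != 0).

Lemma find_class_spec r m t w : globals r -> r 7 = t -> r 12 = w -> w < n ->
  t <= B ->
  triple B find_class (r, m) (20 * n0 + 20) (fun s' =>
    [/\ same_regs 11 r s'.1, s'.2 = m
      & (s'.1 13 = 0 /\ forall u, u < n0 -> ~~ is_pred m t w u) \/
        (exists u, [/\ u < n0, s'.1 13 = D + u.+1 * L & is_pred m t w u])]).
Proof.
move=> g r7 r12 lt_w le_t; pose addr u := D + u.+1 * L;
  set good := is_pred m t w.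
have leD : D + 2 * L <= B.
  by apply: leq_trans leB; rewrite leq_add2l leq_mul2r leq_addl orbT.
pose I k (s : state) := [/\ same_regs 11 r s.1 /\ s.1 12 = w,
  s.1 11 = k /\ k <= n0,
  s.2 = m, s.1 14 = D + (n0 - k) * L
  & (s.1 13 = 0 /\ forall u, u < n0 - k -> ~~ good u) \/
        (exists u, [/\ u < n0, s.1 13 = addr u & good u])].
apply: (@triple_leq _ _ _ (3 + (n0 * 15).+1)); last by lia.
apply: (@triple_seq _ _ _ _ _ _ (I n0)).
  apply: triple_wp; rewrite /= (reg0 g) (reg2 g) (reg5 g) !addn0.
  split; first by do !split; lia.
  split=> //=; try by lia.
  - by split=> //; do !apply: same_upd => //.
  - by left; split=> // u; lia.
move=> s1 I1; apply: triple_conseq (triple_for (I := I) _ _ I1) (leqnn _) _.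
- by move=> k s [_ []].
- move=> k [r' m'] Is; rewrite /I /= in Is.
  case: Is => [[same q12] [r11 le_k] -> r14 found].
  have g' := same_globals same isT g.
  have r7' : r' 7 = t by rewrite same.
  set u := n0 - k.+1 in r14 found.
  have lt_u : u < n0 by rewrite /u; lia.
  have addrE : addr u = r' 14 + L by rewrite r14 /addr mulSnr addnA.
  have le_u : addr u + L <= B by apply: row_le.
  split; first by rewrite /= r7' (reg4 g') -addrE (reg3 g') q12; do !split; lia.
  rewrite [block_effect _ _]/= r7' (reg4 g') (reg1 g') -addrE (reg3 g') q12 r11.
  set r1 := (X in (X, m)).
  have same1 : same_regs 11 r r1 by do !apply: same_upd => //.
  have [p12 [p11 [p13 [p14 [p15 p16]]]]] : r1 12 = w /\ r1 11 = k /\ r1 13 = r'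
    13 /\
    r1 14 = addr u /\ r1 15 = addr u - t + (t - addr u) /\
    r1 16 = m (addr u + n + w) by rewrite /r1 /=; do !split; lia.
  have goodE : good u = (r1 15 != 0) && (r1 16 != 0).
    by rewrite p15 p16 /good /is_pred -/(addr u) addnA; congr (_ && _); lia.
  have uS : n0 - k = u.+1 by rewrite /u; lia.
  have bad : ~~ good u -> I k (r1, m).
    move=> bad_u; split=> //=; first by lia.
      by rewrite p14 uS.
    rewrite p13; case: found => [[-> no]|]; [left; split=> // v|by right].
    rewrite uS ltnS leq_eqVlt => /predU1P[->//|]; exact: no.
  clearbody r1; split=> [p15N0|p15_0]; last first.
    by split=> //; apply: bad; rewrite goodE [r1 15]p15_0.
  split=> [p16N0|p16_0]; last first.
    by split=> //; apply: bad; rewrite goodE [r1 16]p16_0 andbF.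
  rewrite /= p14 (reg0 (same_globals same1 isT g)) addn0; split;
    first by do !split; lia.
  split=> //=; [by split=> //; do !apply: same_upd => //|by lia|by rewrite p14
    uS|].
  by right; exists u; rewrite lt_u goodE p15N0 p16N0.
- by case=> r' m' [[same _] _ mE _]; rewrite subn0.
Qed.

Lemma merge_rows_spec r m p t : globals r -> r 13 = p -> r 7 = t ->
  p + L <= B -> t + L <= B -> p + L <= t \/ t + L <= p ->
  (forall y, y < n + n -> m (p + y) + m (t + y) <= B) ->
  triple B merge_rows (r, m) (25 * n + 20) (fun s' =>
    [/\ same_regs 11 r s'.1 /\ s'.1 13 = p,
        forall y, y < n + n -> s'.2 (p + y) = m (p + y) + m (t + y),
        forall y, y < n + n -> s'.2 (t + y) = 0
      & forall a, ~~ (p <= a < p + (n + n)) -> ~~ (t <= a < t + (n + n)) ->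
        s'.2 a = m a]).
Proof.
move=> g r13 r7 le_p le_t disj le_sum.
pose I k (s : state) := [/\ same_regs 11 r s.1 /\ s.1 13 = p,
  s.1 11 = k /\ k <= n + n, s.1 16 = n + n - k,
  forall y, y < n + n -> s.2 (p + y) = m (p + y) + (y < n + n - k) * m (t + y)
    /\
                         s.2 (t + y) = (n + n - k <= y) * m (t + y)
  & forall a, ~~ (p <= a < p + (n + n)) -> ~~ (t <= a < t + (n + n)) ->
        s.2 a = m a].
apply: (@triple_leq _ _ _ (2 + ((n + n) * 11).+1)); last by lia.
apply: (@triple_seq _ _ _ _ _ _ (I (n + n))).
  apply: triple_wp; rewrite /= (reg0 g) (reg6 g) !addn0.
  split; first by do !split; lia.
  split=> //=; [by split=> //; do !apply: same_upd => //|by rewrite subnn|].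
  by move=> y _; rewrite subnn ltn0 leq0n mul0n mul1n addn0.
move=> s1 I1; apply: triple_conseq (triple_for (I := I) _ _ I1) (leqnn _) _.
- by move=> k s [_ []].
- move=> k [r' m'] Is; rewrite /I /= in Is.
  case: Is => [[same q13] [r11 le_k] r16 mE frame].
  have g' := same_globals same isT g.
  have r7' : r' 7 = t by rewrite same.
  set y := n + n - k.+1 in r16 mE.
  have lt_y : y < n + n by rewrite /y; lia.
  have yS : n + n - k = y.+1 by rewrite /y; lia.
  have [mp mt] := mE y lt_y; rewrite ltnn leqnn mul0n addn0 mul1n in mp mt.
  have le_s := le_sum y lt_y.
  rewrite /= q13 r7' r16 (reg0 g') (reg1 g') (reg6 g') mp mt.
  split; first by do !split; lia.
  split=> /=; [by split=> //; do !apply: same_upd => //|by lia|by lia| |].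
    move=> z lt_z; rewrite yS; have [mzp mzt] := mE z lt_z.
    have [->|neq] := eqVneq z y.
      by rewrite upd_neq ?upd_eq ?ltnSn ?ltnn ?mul1n ?mul0n; lia.
    by rewrite !upd_neq ?mzp ?mzt ?ltnS; lia.
  move=> a np nt; have [ne_p ne_t] : a != p + y /\ a != t + y by lia.
  by rewrite upd_neq // upd_neq // frame.
- case=> r' m' [same _ _ mE frame]; split=> // y lt_y.
    by have [-> _] := mE y lt_y; rewrite subn0 lt_y mul1n.
  by have [_ ->] := mE y lt_y; rewrite subn0 leqNgt lt_y mul0n.
Qed.

(** The final value of register 14 and the registers above it are recorded so that a second filling
    can continue where the first one stopped. *)
Lemma fill_spec r m i b : globals r -> 11 < i -> i != 14 -> r 14 + n <= B ->
  r i = b ->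
  triple B (fill i) (r, m) (5 * n + 3) (fun s' =>
    [/\ same_regs 11 r s'.1, s'.1 14 = r 14 + n,
        forall j, 14 < j -> s'.1 j = r j
      & forall a, s'.2 a = if r 14 <= a < r 14 + n then b else m a]).
Proof.
move=> g lt_i ne_i le_end ri.
pose I k (s : state) := [/\ same_regs 11 r s.1 /\ (forall j, 14 < j -> s.1 j =
  r j),
  s.1 11 = k /\ k <= n, s.1 i = b, s.1 14 = r 14 + (n - k)
  & forall a, s.2 a = if r 14 <= a < r 14 + (n - k) then b else m a].
have ne_i11 : i != 11 by lia.
apply: (@triple_leq _ _ _ (1 + (n * 5).+1)); last by lia.
apply: (@triple_seq _ _ _ _ _ _ (I n)).
  apply: triple_wp; rewrite /= (reg0 g) (reg3 g) !addn0.
  split; first by do !split; lia.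
  split=> //=; try by lia.
  - split; first by do !apply: same_upd => //.
    by move=> j lt_j; rewrite upd_neq //; lia.
  - by rewrite upd_neq.
  - by move=> a; rewrite subnn addn0; case: ltngtP.
move=> s1 I1; apply: triple_conseq (triple_for (I := I) _ _ I1) (leqnn _) _.
- by move=> k s [_ []].
- move=> k [r' m'] Is; rewrite /I /= in Is.
  case: Is => [[same high] [r11 le_k] r'i r14 mE].
  have g' := same_globals same isT g.
  rewrite /= r14 r11 (reg1 g') r'i; split; first by do !split; lia.
  split=> /=; [|by lia| |by lia|].
  + by split; [do !apply: same_upd => //|move=> j lt_j;
    rewrite !upd_neq ?high //; lia].
  + by rewrite !upd_neq.
  + move=> a; have [->|neq] := eqVneq a (r 14 + (n - k.+1)).
      by rewrite upd_eq ifT; lia.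
    by rewrite upd_neq // mE; congr (if _ then _ else _); lia.
- by case=> r' m' [[same high] _ _ r14 mE]; rewrite subn0 in r14 mE.
Qed.

End Specs.

(** * Contraction of mutually forceable vertices *)

Section Contraction.
Variable G : connectivity_game.
Notation V0 := (V0 G).
Notation V1 := (V1 G).
Notation V := (vertex G).
Let v0 (x : V0) : V := inl x.
Let v1 (w : V1) : V := inr w.
Implicit Types (x y u t p : V0) (w : V1) (cl : V0 -> V0).

(* [cl] maps every vertex to the representative of its class.  A class can be
   forced from any class above it on the stack [t :: rest]; [lk] links each
   stack entry to the one below and vanishes outside the stack. *)
Variable ptr : V0 -> nat.

Fixpoint chain (lk : V0 -> nat) t (rest : seq V0) : Prop :=
  if rest is p :: rest' then
    [/\ forces (v0 t) (v0 p), lk t = ptr p & chain lk p rest']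
  else lk t <> 0.

Record contracted cl t (rest : seq V0) (lk : V0 -> nat) : Prop := Contracted {
  cl_idem : forall x, cl (cl x) = cl x;
  cl_forces : forall x y, cl x = cl y -> forces (v0 x) (v0 y);
  stack_chain : chain lk t rest;
  stack_uniq : uniq (t :: rest);
  stack_reps : {in t :: rest, forall u, cl u = u};
  stack_links : forall u, cl u = u -> (lk u != 0) = (u \in t :: rest) }.

Definition reps cl := [set u | cl u == u].

Lemma chain_forces lk t rest u : chain lk t rest -> u \in t :: rest ->
  forces (v0 t) (v0 u).
Proof.
elim: rest t => [|p rest IHrest] t /=.
  by move=> _; rewrite inE => /eqP->; exact: forces_refl.
case=> tp _ /IHrest pu; rewrite inE => /predU1P[->|/pu];
  first exact: forces_refl.
exact: forces_trans.
Qed.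

Lemma chain_ext lk lk' t rest : {in t :: rest, lk =1 lk'} ->
  chain lk t rest -> chain lk' t rest.
Proof.
elim: rest t => [|p rest IHrest] t eq_lk /=; first by rewrite eq_lk ?mem_head.
case=> tp lkt ch; split=> //; first by rewrite -eq_lk ?mem_head.
by apply: IHrest ch => u pu; apply: eq_lk; rewrite inE pu orbT.
Qed.

Lemma contracted_ext cl t rest lk lk' : lk =1 lk' ->
  contracted cl t rest lk -> contracted cl t rest lk'.
Proof.
move=> eq_lk [idem cf ch un reps_s links]; split=> //.
  by apply: chain_ext ch => u _.
by move=> u; rewrite -eq_lk; exact: links.
Qed.

(** * One round: pivot, push, merge *)

Section Step.
Variables (cl : V0 -> V0) (t : V0) (rest : seq V0) (lk : V0 -> nat).
Hypothesis ctr : contracted cl t rest lk.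

Lemma top_rep : cl t = t.
Proof. by apply: (stack_reps ctr); rewrite mem_head. Qed.

(** Player 0 goes from [cl x] to [x] within the class and then moves to [w]; wherever player 1 goes
    from there, the token is in the class of [t]. The successor [y] keeps [w] from being a dead
    end. *)
Lemma pivot_forces w x : (exists y, edge (v1 w) (v0 y)) ->
  (forall y, edge (v1 w) (v0 y) -> cl y = t) -> edge (v0 x) (v1 w) ->
  forces (v0 (cl x)) (v0 t).
Proof.
move=> [y0 wy0] all_t xw.
apply: (@forces_trans _ (v0 x)); first by apply: (cl_forces ctr);
  rewrite (cl_idem ctr).
apply: (forces_P0 (v := v1 w)) => //; apply: forces_P1 => //.
  by apply/dead_endPn; exists (v0 y0).
case=> [y wy|w' ww']; last by case: (edge_owner ww').
by apply: (cl_forces ctr); rewrite (all_t y wy) top_rep.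
Qed.

Lemma contracted_push u : cl u = u -> lk u = 0 -> ptr t != 0 ->
  forces (v0 u) (v0 t) ->
  contracted cl u (t :: rest) (fun x => if x == u then ptr t else lk x).
Proof.
move=> clu lku ptr_t ut; have u_new : u \notin t :: rest.
  by rewrite -(stack_links ctr clu) lku.
case: ctr => idem cf ch un reps_s links; split=> //.
- rewrite /= eqxx; split=> //; apply: chain_ext ch => x x_st.
  by rewrite ifN //; apply: contraNneq u_new => <-.
- by rewrite cons_uniq u_new.
- by move=> x; rewrite inE => /predU1P[->//|/reps_s].
- by move=> x clx; rewrite in_cons; case: (x =P u) => [//|_]; exact: links.
Qed.

Definition merged p : V0 -> V0 := fun x => if cl x == t then p else cl x.

(** The chain from [p] to [u], followed by [ut], yields the missing direction from [p] to [t]. The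
    link of [t] stays nonzero, consistently with [stack_links], which speaks of representatives
    only. *)
Lemma contracted_merge p rest' u : rest = p :: rest' -> u \in rest ->
  forces (v0 u) (v0 t) -> contracted (merged p) p rest' lk.
Proof.
move=> def_rest u_rest ut; case: ctr => idem cf ch un reps_s links.
move: ch un reps_s links u_rest; rewrite def_rest /=.
case=> tp _ ch /andP[t_new un] reps_s links u_rest.
have pt : forces (v0 p) (v0 t) by apply: forces_trans ut;
  apply: chain_forces ch _.
have clp : cl p = p by apply: reps_s; rewrite !inE eqxx orbT.
have clt : cl t = t by apply: reps_s; rewrite mem_head.
have neq_pt : p != t by apply: contraNneq t_new => ->; rewrite mem_head.
have to_t x : cl x = t -> forces (v0 x) (v0 t) by move=> clx; apply: cf;
  rewrite clx clt.
have of_t x : cl x = t -> forces (v0 t) (v0 x) by move=> clx; apply: cf;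
  rewrite clx clt.
have to_p x : p = cl x -> forces (v0 x) (v0 p) by move=> clx; apply: cf;
  rewrite -clx clp.
have of_p x : p = cl x -> forces (v0 p) (v0 x) by move=> clx; apply: cf;
  rewrite -clx clp.
rewrite /merged; split=> //.
- move=> x; case: (eqVneq (cl x) t) => [_|neq_xt]; first by rewrite clp ifN.
  by rewrite idem ifN.
- move=> x y; case: eqP => [xt|_]; case: eqP => [yt|_].
  + by move=> _; apply: cf; rewrite xt yt.
  + by move/of_p; apply: forces_trans; apply: forces_trans tp; exact: to_t.
  + by move/esym/to_p => xp; apply: (forces_trans xp);
    apply: (forces_trans pt); exact: of_t.
  + exact: cf.
- move=> x x_st; rewrite reps_s ?ifN //; last by rewrite inE x_st orbT.
  by apply: contraNneq t_new => <-.
- move=> x; case: eqP => [clx <-|neq_xt clx].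
    by rewrite links ?clp // inE (negPf neq_pt).
  by rewrite links // inE; case: eqP => // xt; case: neq_xt; rewrite xt.
Qed.

Lemma reps_merge p : cl p = p -> p != t -> reps (merged p) = reps cl :\ t.
Proof.
move=> clp neq_pt; apply/setP => x; rewrite !inE /merged.
have [clx|neq_x] := eqVneq (cl x) t.
  rewrite clx [t == x]eq_sym andNb; apply: contraNF neq_pt => /eqP def_x.
  by rewrite -clx -def_x clp.
by rewrite andb_idl // => /eqP <-.
Qed.

End Step.

Lemma contracted1_forces cl t rest lk : contracted cl t rest lk ->
  #|reps cl| = 1 -> forall x y, forces (v0 x) (v0 y).
Proof.
move=> ctr /eqP/cards1P[u def_u] x y; apply: (cl_forces ctr).
have clE z : cl z = u by apply/set1P; rewrite -def_u inE (cl_idem ctr).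
by rewrite !clE.
Qed.

Lemma forces_V0_Win_P0 : 0 < #|V0| -> 0 < #|V1| ->
  (forall x y, forces (v0 x) (v0 y)) ->
  (forall w, exists x, edge (v1 w) (v0 x)) ->
  (forall w, exists x, edge (v0 x) (v1 w)) ->
  forall v : V, Win P0 v.
Proof.
move=> /card_gt0P[x0 _] /card_gt0P[w0 _] fxy out inn.
have to_V1 x w : forces (v0 x) (v1 w).
  have [y yw] := inn w; apply: forces_trans (fxy x y) _.
  exact: forces_P0 yw (forces_refl _).
have of_V1 w (v : V) : (forall x, forces (v0 x) v) -> forces (v1 w) v.
  move=> f_v; have [x wx] := out w; apply: forces_P1 => //.
    by apply/dead_endPn; exists (v0 x).
  by case=> [y _|w' ww']; [exact: f_v | case: (edge_owner ww')].
have f_all (v v' : V) : forces v v'.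
  have f_x x : forces (v0 x) v' by case: v' => [y|w]; [exact: fxy|exact: to_V1].
  by case: v => [x|w]; [exact: f_x|exact: of_V1].
apply: forces_Win_P0 => // -[x|w].
  (* A vertex from which a different vertex is forced has a move; [w0] differs from [x] by its
     side. *)
  exact: (@forces_live _ (v0 x) (v1 w0)).
by have [x wx] := out w; apply/dead_endPn; exists (v0 x).
Qed.

Lemma degree0_Win_P1 : #|V0| = 0 \/ #|V1| = 0 \/
   (exists w, (forall x, ~~ edge (v1 w) (v0 x)) \/ (forall x, ~~ edge (v0 x)
     (v1 w))) ->
  forall v : V, Win P1 v.
Proof.
move=> deg v; apply: never_won_Win_P1 => -[x p _ []|f] play_f won.
have alt i : owner (f i) <> owner (f i.+1) by apply: edge_owner.
case: deg => [n0|[n1|[w deg]]].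
- have no x : False by have := card0_eq n0 x; rewrite inE.
  by have := alt 0; case: (f 0) => [/no//|w]; case: (f 1) => [/no//|].
- have no w : False by have := card0_eq n1 w; rewrite inE.
  by have := alt 0; case: (f 0) => [x|/no//]; case: (f 1) => [|/no//].
(* A visit at a position at least 1 has both a predecessor and a successor in the play. *)
have [[|i] // _ fi] := won (v1 w) 1.
case: deg => [out0|in0].
  have := play_f i.+1; rewrite fi; case: (f i.+2) => [x|w' ww'].
    by rewrite (negPf (out0 x)).
  by case: (edge_owner ww').
have := play_f i; rewrite fi; case: (f i) => [x|w' ww'].
  by rewrite (negPf (in0 x)).
by case: (edge_owner ww').
Qed.

End Contraction.

(** * The contraction loop *)

Definition merge_top : cmd :=
  Seq (Block [:: IAdd 14 7 6; ILoad 13 14])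
  (Seq merge_rows (Block [:: IAdd 7 13 0; ISub 8 8 1])).

Definition contract_step : cmd :=
  If 8
    (Seq find_pivot
      (If 12
        (Seq find_class
          (Seq (Block [:: IAdd 14 13 6; ILoad 15 14])
            (If 15 merge_top (Block [:: IStore 14 7; IAdd 7 13 0]))))
        (Block [:: IConst 10 0])))
    (Block [:: IConst 9 1; IConst 10 0]).

Definition contract_all : cmd := While 10 contract_step.

(** The bottom of the stack is linked to itself: its link only has to be nonzero, marking the class
    as already met. *)
Definition solve : cmd :=
  Seq (Block [:: IAdd 7 5 4; IAdd 14 7 6; IStore 14 7; ISub 8 2 1; IConst 9 0])
      contract_all.

Section Contract.
Variable G : connectivity_game.
Notation V0 := (V0 G).
Notation V1 := (V1 G).
Notation V := (vertex G).
Notation n0 := #|V0|.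
Notation n1 := #|V1|.
Let v0 (x : V0) : V := inl x.
Let v1 (w : V1) : V := inr w.
Variables B n L D : nat.
Hypotheses (def_n : n = n0 + n1) (def_L : L = n + n + 1) (D_gt0 : 0 < D).
Hypothesis leB : D + (n0 + 2) * L <= B.

(** * Layout of the rows and edge counts *)

Definition row_ptr (x : V0) := D + (enum_rank x).+1 * L.
Definition wcode (w : V1) : nat := n0 + enum_rank w.

(* Slot [wcode w] of a row counts the edges from [w] into the class of the row,
   slot [n + wcode w] those from the class to [w]. *)
Definition adj (y : nat) (x : V0) : bool :=
  [exists w : V1, (y == wcode w) && edge (v1 w) (v0 x)
               || (y == n + wcode w) && edge (v0 x) (v1 w)].

Lemma wcode_bounds w : n0 <= wcode w < n.
Proof. by rewrite leq_addr def_n ltn_add2l ltn_ord. Qed.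

Lemma wcode_inj : injective wcode.
Proof. by move=> w w' /addnI/val_inj/enum_rank_inj. Qed.

Lemma wcodeP y : n0 <= y < n -> exists w, y = wcode w.
Proof.
case/andP=> le_y lt_y; have lt_i : y - n0 < n1 by lia.
exists (enum_val (Ordinal lt_i)); by rewrite /wcode enum_valK /= subnKC.
Qed.

Lemma adj_out w x : adj (wcode w) x = edge (v1 w) (v0 x).
Proof.
apply/existsP/idP => [[w']|wx]; last by exists w; rewrite eqxx wx.
have w_ok := wcode_bounds w; have w'_ok := wcode_bounds w'.
by case/orP=> /andP[/eqP eq_w] //; [move/wcode_inj: eq_w => -> | lia].
Qed.

Lemma adj_in w x : adj (n + wcode w) x = edge (v0 x) (v1 w).
Proof.
apply/existsP/idP => [[w']|wx]; last by exists w; rewrite eqxx wx orbT.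
have w_ok := wcode_bounds w; have w'_ok := wcode_bounds w'.
by case/orP=> /andP[/eqP eq_w] //; [lia | rewrite (_ : w = w') //;
  apply: wcode_inj; lia].
Qed.

Lemma row_ptr_le u : row_ptr u + L <= B.
Proof. by apply: (row_le leB); apply: ltn_ord. Qed.

Lemma row_ptr_ge u : D + L <= row_ptr u.
Proof. by rewrite leq_add2l mulSnr leq_addl. Qed.

Lemma row_ptr_disjoint u v : u != v ->
  row_ptr u + L <= row_ptr v \/ row_ptr v + L <= row_ptr u.
Proof.
move=> neq; rewrite /row_ptr -!addnA -!mulSnr !leq_add2l !leq_mul2r.
have : enum_rank u != enum_rank v :> nat.
  by apply: contra_neq neq => /val_inj/enum_rank_inj.
by case: ltngtP; [left|right|]; rewrite ?ltnS ?orbT //; apply/orP; right; lia.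
Qed.

Lemma row_ptr_neq u v y z : u != v -> y < L -> z < L ->
  row_ptr u + y != row_ptr v + z.
Proof. by move/row_ptr_disjoint => *; lia. Qed.

Lemma row_ptr_inj : injective row_ptr.
Proof.
move=> u v eq_uv; apply/eqP; apply: contra_eqT eq_uv => neq.
by have /row_ptr_disjoint := neq; lia.
Qed.

Definition links (m : nat -> nat) (u : V0) := m (row_ptr u + (n + n)).

Record represents (m : nat -> nat) (cl : V0 -> V0) : Prop := Represents {
  rowsE : forall u y, y < n + n ->
    m (row_ptr u + y) = \sum_(x | cl x == u) adj y x;
  totalsE : forall y, n0 <= y < n + n -> m (D + y) = \sum_x adj y x }.

Lemma outside_class m cl u y : represents m cl -> n0 <= y < n + n ->
  m (D + y) - m (row_ptr u + y) = \sum_(x | cl x != u) adj y x.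
Proof.
move=> rep /[dup] y_ok /andP[_ lt_y]; rewrite (totalsE rep) // (rowsE rep) //.
by rewrite (bigID (fun x => cl x == u)) addKn.
Qed.

Lemma sum_adj_gt0 (P : pred V0) y :
  (\sum_(x | P x) adj y x != 0) = [exists x, P x && adj y x].
Proof.
rewrite sum_nat_eq0 negb_forall; apply: eq_existsb => x.
by rewrite negb_imply eqb0 negbK.
Qed.

Lemma sum_adj_le (P : pred V0) y : \sum_(x | P x) adj y x <= n0.
Proof.
rewrite -sum1_card big_mkcond leq_sum // => x _; by case: (P x); case: adj.
Qed.

Definition settled (s : state) : Prop :=
  s.1 9 = 1 /\ (forall v : V, Win P0 v) \/ s.1 9 = 0 /\ (forall v : V, Win P1
    v).

Definition contracting (s : state) : Prop :=
  exists cl t rest,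
    [/\ represents s.2 cl, contracted row_ptr cl t rest (links s.2),
        s.1 7 = row_ptr t, (s.1 8).+1 = #|reps cl| & s.1 9 = 0].

(** A merge lowers the first summand and a push the second; the final 1 pays for the round that
    stops the loop. *)
Definition measure (s : state) := s.1 8 + #|[set u | links s.2 u == 0]| + 1.

Definition loop_inv k (s : state) : Prop :=
  [/\ globals n0 n L D s.1, s.1 10 = 0 -> settled s
    & s.1 10 != 0 -> contracting s /\ measure s <= k].

Section Degrees.
Hypotheses (V0_gt0 : 0 < n0) (V1_gt0 : 0 < n1).
Hypothesis out_deg : forall w, exists x, edge (v1 w) (v0 x).
Hypothesis in_deg : forall w, exists x, edge (v0 x) (v1 w).

Lemma merge_represents m m' cl p t : represents m cl -> p != t ->
  cl p = p ->
  (forall y, y < n + n -> m' (row_ptr p + y) = m (row_ptr p + y) + m (row_ptr t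
    + y)) ->
  (forall y, y < n + n -> m' (row_ptr t + y) = 0) ->
  (forall a, ~~ (row_ptr p <= a < row_ptr p + (n + n)) ->
     ~~ (row_ptr t <= a < row_ptr t + (n + n)) -> m' a = m a) ->
  represents m' (merged cl t p).
Proof.
move=> rep neq_pt clp m'p m't frame; split=> [u y lt_y|y y_ok].
  have [->|neq_up] := eqVneq u p.
    rewrite m'p // !(rowsE rep) // [RHS](bigID (fun x => cl x == t)) addnC /=.
    congr (_ + _); apply: eq_bigl => x; rewrite /merged.
      by case: ifP; rewrite ?eqxx ?andbF.
    by case: ifP => [/eqP->|]; rewrite ?andbT // andbF eq_sym (negPf neq_pt).
  have [->|neq_ut] := eqVneq u t.
    rewrite m't // big1 // => x; rewrite /merged;
      case: ifP => [_ /eqP def_p|->//].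
    by rewrite def_p eqxx in neq_pt.
  rewrite frame ?(rowsE rep) //; first last.
  - by have := row_ptr_disjoint neq_ut; lia.
  - by have := row_ptr_disjoint neq_up; lia.
  apply: eq_bigl => x; rewrite /merged; case: ifP => // /eqP->.
  by rewrite ![_ == u]eq_sym (negPf neq_up) (negPf neq_ut).
rewrite frame ?(totalsE rep) //.
  by have := row_ptr_ge p; lia.
by have := row_ptr_ge t; lia.
Qed.

Lemma contract_step_spec k s : loop_inv k s -> s.1 10 != 0 ->
  exists2 k', k = k'.+1 &
    triple B contract_step s (70 * n + 120) (loop_inv k').
Proof.
case: s => r m [/= g _ inv r10].
case: (inv r10) => [[cl [t [rest [/= rep ctr r7 r8 r9]]]] meas].
case: k meas {inv} => [|k]; first by rewrite /measure addn1.
rewrite /measure addn1 ltnS /= => meas; exists k => //.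
apply: (@triple_leq _ _ _ ((25 * n + 20) + ((20 * n0 + 20) +
  (2 + (2 + ((25 * n + 20) + 2)).+2)).+2).+2); last by lia.
apply: triple_if => /= [r8N|r8_0]; last first.
  apply: (@triple_leq _ _ _ 2); last by lia.
  apply: triple_wp => /=; split; first by do !split; lia.
  split=> //=; first by case: g.
  move=> _; left; split=> //; apply: forces_V0_Win_P0 => //.
  by apply: contracted1_forces ctr _; rewrite -r8 r8_0.
apply: triple_seq (find_pivot_spec def_n def_L leB g r7 (row_ptr_le t)) _.
move=> [r1 m1] [/= same1 ->]; set good := is_pivot _ _ _ _.
have g1 := same_globals same1 isT g.
have goodE w : good (wcode w) =
    [forall (x | cl x != t), ~~ edge (v1 w) (v0 x)] &&
    [exists (x | cl x != t), edge (v0 x) (v1 w)].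
  have w_ok := wcode_bounds w.
  rewrite /good /is_pivot !(outside_class _ rep); [|lia|lia]; congr (_ && _).
    rewrite -[LHS]negbK sum_adj_gt0 negb_exists; apply: eq_forallb => x.
    by rewrite negb_and adj_out implybE.
  by rewrite sum_adj_gt0; apply: eq_existsb => x; rewrite adj_in.
move=> found; apply: triple_if => /= [r12N|r12_0]; last first.
  case: found => [[_ no_good]|[]]; last by rewrite r12_0 leqNgt V0_gt0.
  apply: (@triple_leq _ _ _ 1); last by lia.
  apply: triple_wp => /=; split; first by do !split; lia.
  split=> //=; first by case: g1.
  move=> _; right; split=> [/=|]; first by rewrite same1.
  have [y0 cl_y0] : exists y0, cl y0 != t.
    have : 1 < #|reps cl| by rewrite -r8 ltnS lt0n.
    rewrite (cardsD1 t) => lt1; have /card_gt0P[y] : 0 < #|reps cl :\ t| by lia.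
    by rewrite !inE => /andP[neq /eqP cly]; exists y; rewrite cly.
  (* Without a pivot, each [w] that can be entered from outside the top class also has a successor
     outside, which is what the trap requires. *)
  apply: (@trap_Win_P1 G (fun x => cl x == t) t y0) => //.
    by rewrite (top_rep ctr).
  move=> x w clx xw; have := no_good _ (wcode_bounds w).
  rewrite goodE negb_and => /orP[];
    rewrite negb_forall_in || rewrite negb_exists_in.
    by case/exists_inP=> y cly; rewrite negbK; exists y.
  by move/forall_inP/(_ x clx); rewrite xw.
have {found} [w [def_w good_w]] : exists w, r1 12 = wcode w /\ good (wcode w).
  case: found => [[r12 _]|[r12 good12]]; first by rewrite r12 in r12N.
  by have [w def_w] := wcodeP r12; exists w; rewrite -def_w.
move: good_w; rewrite goodE => /andP[/forall_inP to_t /exists_inP[x0 clx0 x0w]].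
have all_t y : edge (v1 w) (v0 y) -> cl y = t.
  by move=> wy; apply/eqP; apply: contraLR wy => /to_t.
have lt_wn : wcode w < n by case/andP: (wcode_bounds w).
have r7' : r1 7 = row_ptr t by rewrite same1.
have le_t : row_ptr t <= B by apply: leq_trans (row_ptr_le t); apply: leq_addr.
apply: triple_seq (find_class_spec def_n def_L leB g1 r7' def_w lt_wn le_t) _.
move=> [r2 m2] [/= same2 -> found].
have {found} [u [def_u neq_ut [x [clx xw]]]] : exists u : V0,
    [/\ r2 13 = row_ptr u, u != t & exists x, cl x = u /\ edge (v0 x) (v1 w)].
  have row_u (u : V0) : (m (row_ptr u + (n + wcode w)) != 0) =
      [exists x, (cl x == u) && edge (v0 x) (v1 w)].
    rewrite (rowsE rep) ?ltn_add2l // sum_adj_gt0.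
    by apply: eq_existsb => x; rewrite adj_in.
  case: found => [[_ none]|[i [lt_i def_i]]].
    (* The search cannot fail: the class of [x0], the predecessor that makes [w] a pivot,
       qualifies. *)
    case/negP: (none _ (ltn_ord (enum_rank (cl x0)))).
    rewrite /is_pred -/(row_ptr (cl x0)) (inj_eq row_ptr_inj) clx0 row_u.
    by apply/existsP; exists x0; rewrite eqxx.
  have def_u : D + i.+1 * L = row_ptr (enum_val (Ordinal lt_i)).
    by rewrite /row_ptr enum_valK.
  rewrite /is_pred def_u in def_i *; case/andP=> neq;
    rewrite row_u => /existsP[x /andP[/eqP clx xw]].
  exists (enum_val (Ordinal lt_i)); split=> //; last by exists x.
  by apply: contraNneq neq => ->.
have ut : forces (v0 u) (v0 t).
  by rewrite -clx; apply: (pivot_forces ctr) xw => //; apply: out_deg.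
have clu : cl u = u by rewrite -clx (cl_idem ctr).
have g2 := same_globals same2 isT g1.
have same02 i : i < 11 -> r2 i = r i by move=> lt_i; rewrite same2 ?same1.
have le_u := row_ptr_le u.
apply: (@triple_seq _ _ _ _ _ _ (fun s => s = (upd (upd r2 14 (row_ptr u + (n +
  n))) 15 (links m u), m))).
  apply: triple_wp; rewrite /= def_u (reg6 g2) /links; split=> //.
  by do !split; lia.
(* Register 15 holds the link of [u]. If it is zero, [u] is not on the stack and is pushed;
   otherwise a cycle has closed. *)
move=> _ ->; apply: triple_if => [|] /=; last first.
  move=> lku; apply: (@triple_leq _ _ _ 2); last by lia.
  apply: triple_wp; rewrite /= def_u (reg0 g2) addn0; split;
    first by do !split; lia.
  have linksE : links (upd m (row_ptr u + (n + n)) (r2 7)) =1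
      (fun x => if x == u then row_ptr t else links m x).
    move=> z; rewrite /links; case: eqVneq => [->|neq_z].
      by rewrite upd_eq same2 // r7'.
    by rewrite upd_neq // row_ptr_neq //; lia.
  split=> /=; [by case: g2|by rewrite same02 // => r10_0;
    rewrite r10_0 in r10|move=> _].
  split.
    exists cl, u, (t :: rest); split=> //=; try by rewrite same02.
    + split=> [v y lt_y|y y_ok].
        rewrite upd_neq ?(rowsE rep) //.
        have [->|neq] := eqVneq v u; last by apply: row_ptr_neq; rewrite //;
          lia.
        by rewrite eqn_add2l neq_ltn lt_y.
      rewrite upd_neq ?(totalsE rep) //; have := row_ptr_ge u; lia.
    + apply: (contracted_ext (fsym linksE)).
      apply: (contracted_push ctr) => //.
      by rewrite -lt0n; have := row_ptr_ge t; lia.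
  rewrite /measure /= same02 // addn1 -addnS (leq_trans _ meas) // leq_add2l.
  apply: proper_card; apply/properP; split; last first.
    exists u; rewrite !inE ?lku // linksE eqxx.
    by rewrite -lt0n; have := row_ptr_ge t; lia.
  apply/subsetP => v; rewrite !inE linksE; case: (eqVneq v u) => // _.
  by move=> /eqP t0; have := row_ptr_ge t; lia.
move=> lku; have u_rest : u \in rest.
  have : u \in t :: rest by rewrite -(stack_links ctr clu).
  by rewrite inE (negPf neq_ut).
case def_rest: rest => [|p rest']; first by rewrite def_rest in u_rest.
have := stack_chain ctr; rewrite def_rest /= => -[_ lkt _].
have p_st : p \in t :: rest by rewrite def_rest !inE eqxx orbT.
have clp := stack_reps ctr p_st.
have neq_pt : p != t.
  have := stack_uniq ctr; rewrite def_rest /= inE negb_or => /andP[/andP[+ _]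
    _].
  by rewrite eq_sym.
have le_sum y : y < n + n -> m (row_ptr p + y) + m (row_ptr t + y) <= B.
  move=> lt_y; rewrite !(rowsE rep) //.
  have := sum_adj_le (fun x => cl x == p) y;
    have := sum_adj_le (fun x => cl x == t) y.
  have : (n0 + 2) * L <= B by apply: leq_trans leB; apply: leq_addl.
  have : n0 + n0 <= (n0 + 2) * L by rewrite addnn -muln2; apply: leq_mul; lia.
  lia.
apply: (@triple_seq _ _ _ _ _ _ (fun s => exists2 r3, s = (r3, m) &
    same_regs 11 r r3 /\ r3 13 = row_ptr p)).
  apply: triple_wp; rewrite /= same2 // r7' (reg6 g2) -/(links m t) lkt.
  split; first by have := row_ptr_le t; do !split; lia.
  eexists; first by []; split=> //.
  by do !apply: same_upd => //.
move=> _ [r3 -> [same3 r13]].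
have r73 : r3 7 = row_ptr t by rewrite same3.
have g3 := same_globals same3 isT g.
apply: triple_seq (merge_rows_spec def_n def_L leB g3 r13 r73 (row_ptr_le p)
  (row_ptr_le t) (row_ptr_disjoint neq_pt) le_sum) _.
move=> [r4 m4] [/= [same4 r413] m4p m4t frame].
have g4 := same_globals same4 isT g3.
have same04 i : i < 11 -> r4 i = r i by move=> lt_i; rewrite same4 ?same3.
apply: triple_wp; rewrite /= r413 (reg0 g4) (reg1 g4) addn0 same04 //.
have le_p := row_ptr_le p; split; first by do !split; lia.
have linksE : links m4 =1 links m.
  move=> z; rewrite /links frame //.
    have [->|neq] := eqVneq z p; first by lia.
    by have := row_ptr_disjoint neq; lia.
  have [->|neq] := eqVneq z t; first by lia.
  by have := row_ptr_disjoint neq; lia.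
have repsE : #|reps cl| = (#|reps (merged cl t p)|).+1.
  by rewrite (reps_merge clp neq_pt) [LHS](cardsD1 t) inE (top_rep ctr) eqxx.
split=> /=; [by case: g4|by rewrite same04 // => r10_0;
  rewrite r10_0 in r10|move=> _].
split.
  exists (merged cl t p), p, rest'; split=> //=.
  - exact: merge_represents m4p m4t frame.
  - apply: (contracted_ext (fsym linksE)).
    exact: (contracted_merge ctr def_rest u_rest ut).
  - by apply: succn_inj; rewrite -repsE -r8; lia.
  - by rewrite same04.
(* The links are unchanged, so the measure drops through the merge counter alone. *)
rewrite /measure /= (eq_card (B := [set u | links m u == 0])); last first.
  by move=> z; rewrite !inE linksE.
lia.
Qed.

Lemma contract_all_spec k s : loop_inv k s ->
  triple B contract_all s (k * (70 * n + 122)).+1 (fun s' =>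
    globals n0 n L D s'.1 /\ settled s').
Proof.
move=> inv_s.
apply: (@triple_conseq _ _ _ (k * (70 * n + 120).+2).+1 _ (fun s' =>
  s'.1 10 = 0 /\ exists k', loop_inv k' s')); last 1 first.
- by move=> s' [r10 [k' [g settled_s _]]]; split; last exact: settled_s.
- by apply: triple_while inv_s => k' s'; exact: contract_step_spec.
- by rewrite ltnS leq_mul2l; lia.
Qed.

End Degrees.

Lemma degrees_okP m : represents m id ->
  reflect [/\ 0 < n0, 0 < n1, forall w, exists x, edge (v1 w) (v0 x)
             & forall w, exists x, edge (v0 x) (v1 w)]
          (degrees_ok n0 n1 n D m).
Proof.
move=> rep; have degE w : ((m (D + wcode w) != 0) && (m (D + (n + wcode w)) !=
  0))
    = [exists x, edge (v1 w) (v0 x)] && [exists x, edge (v0 x) (v1 w)].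
  have w_ok := wcode_bounds w.
  rewrite !(totalsE rep) ?sum_adj_gt0; [|lia|lia].
  by congr (_ && _); apply: eq_existsb => x /=; rewrite ?adj_out ?adj_in.
apply: (iffP and3P) => [[n0_gt0 n1_gt0 /allP deg]|[n0_gt0 n1_gt0 out inn]];
  split=> //.
- move=> w; have : wcode w \in iota n0 n1 by rewrite mem_iota -def_n
  wcode_bounds.
  by move/deg; rewrite degE => /andP[/existsP].
- move=> w; have : wcode w \in iota n0 n1 by rewrite mem_iota -def_n
  wcode_bounds.
  by move/deg; rewrite degE => /andP[_ /existsP].
apply/allP => y; rewrite mem_iota -def_n => /wcodeP[w ->]; rewrite degE.
by apply/andP; split; apply/existsP; [exact: out | exact: inn].
Qed.

Lemma solve_spec r m : globals n0 n L D r -> represents m id ->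
  (forall u, links m u = 0) -> r 10 = degrees_ok n0 n1 n D m ->
  triple B solve (r, m) (5 + (2 * n0 * (70 * n + 122)).+1) (fun s' =>
    globals n0 n L D s'.1 /\ settled s').
Proof.
move=> g rep links0 r10.
have leB2 : D + 2 * L <= B.
  by apply: leq_trans leB; rewrite leq_add2l leq_mul2r leq_addl orbT.
pose m' := upd m (D + L + (n + n)) (D + L).
apply: (@triple_seq _ _ _ _ _ _ (fun s => exists2 r', s = (r', m') &
  [/\ globals n0 n L D r', r' 7 = D + L, r' 8 = n0 - 1, r' 9 = 0 & r' 10 = r
    10])).
  apply: triple_wp; rewrite /= (reg1 g) (reg2 g) (reg4 g) (reg5 g) (reg6 g).
  split; first by do !split; lia.
  by eexists; first by []; split=> //; case: g.
move=> _ [{g}r' -> [g r7 r8 r9]]; rewrite {}r10.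
case: (degrees_okP rep) => [[n0_gt0 n1_gt0 out inn]|deg0] r10; last first.
  (* After a failed degree check register 10 is already zero: the loop body never runs and the
     answer 0 stands. *)
  apply: (@triple_conseq _ _ _ (0 * 2).+1 _ (fun s' => s'.1 10 = 0 /\
    exists k', k' = 0 /\ s' = (r', m'))); last 1 first.
  - move=> _ [_ [_ [_ ->]]]; split=> //; right; split=> //.
    apply: degree0_Win_P1.
    have [n0_0|n0_gt0] := posnP n0; first by left.
    have [n1_0|n1_gt0] := posnP n1; first by right; left.
    right; right; have [w] : exists w, ~~ ([exists x, edge (v1 w) (v0 x)] &&
        [exists x, edge (v0 x) (v1 w)]).
      apply/existsP; rewrite -negb_forall; apply/forallP => deg; apply: deg0.
      by split=> // w; have /andP[/existsP ? /existsP ?] := deg w.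
    rewrite negb_and !negb_exists => no; exists w.
    by case/orP: no => /forallP; [left | right].
  - apply: (@triple_while _ _ _ (fun k' s' => k' = 0 /\ s' = (r', m'))) => //.
    by move=> k' s' [_ ->]; rewrite /= r10.
  - by [].
have [t0 t0_0] : exists t0 : V0, enum_rank t0 = 0 :> nat.
  by exists (enum_val (Ordinal n0_gt0)); rewrite enum_valK.
have ptr_t0 : row_ptr t0 = D + L by rewrite /row_ptr t0_0 mul1n.
apply: contract_all_spec => //; split=> //=; first by rewrite r10.
have linksE : links m' =1 fun u => if u == t0 then D + L else 0.
  move=> u; rewrite /links /m' -ptr_t0; case: eqVneq => [->|neq].
    by rewrite upd_eq.
  by rewrite upd_neq ?row_ptr_neq -?/(links m u) ?links0 //; lia.
move=> _; split; last first.
  (* At the start [n0 - 1] merges are due and at most [n0] links are null, whence [2 * n0]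
     rounds. *)
  rewrite /measure /= r8 (@leq_trans (n0 - 1 + n0 + 1)) //;
    last by rewrite addnAC subnK // mul2n addnn.
  by rewrite leq_add2r leq_add2l max_card.
exists id, t0, [::]; split=> //=.
- split=> [u y lt_y|y y_ok].
    rewrite -(rowsE rep) // /m' -ptr_t0 upd_neq //.
    have [->|neq] := eqVneq u t0; last by apply: row_ptr_neq; rewrite //; lia.
    by rewrite eqn_add2l neq_ltn lt_y.
  by rewrite -(totalsE rep) // /m' upd_neq //; lia.
- split=> //=.
  + by move=> x y ->; exact: forces_refl.
  + by rewrite linksE eqxx; lia.
  + by move=> u _; rewrite linksE inE; case: (eqVneq u t0) => // _; lia.
- by rewrite ptr_t0.
- rewrite r8 (_ : reps id = setT) ?cardsT; first by rewrite subn1 prednK.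
  by apply/setP => x; rewrite !inE eqxx.
Qed.

End Contract.

(** * Input, output and running time *)

Definition write_output : cmd :=
  Seq (Block [:: ISub 15 1 9; IAdd 16 9 0; IAdd 14 0 0])
      (Seq (fill 16) (fill 15)).

Definition connectivity_solver : cmd :=
  Seq read_header (Seq row_pointers (Seq load_edges (Seq check_degrees
    (Seq solve write_output)))).

Section Input.
Variable G : connectivity_game.
Notation V0 := (V0 G).
Notation V1 := (V1 G).
Notation V := (vertex G).
Notation n0 := #|V0|.
Notation n1 := #|V1|.
Variable es : seq (V * V).
Hypothesis es_ok : lists_edges es.

Let n := n0 + n1.
Let L := n + n + 1.
Let D := 3 + size es + size es.

Definition code_pair (e : V * V) := (code e.1, code e.2).

(** * From the list of edges to the counts *)

Definition hits (u : V0) (y : nat) (e : V * V) : bool :=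
  match e with
  | (inl x, inr w) => (x == u) && (y == n + wcode w)
  | (inr w, inl x) => (x == u) && (y == wcode w)
  | _ => false
  end.

(** The row gives the end in [V0], the slot gives the end in [V1] and the direction. For a
    duplicate-free list, every initial count is therefore 0 or 1. *)
Lemma hits_inj u y e e' : hits u y e -> hits u y e' -> e = e'.
Proof.
have ok := @wcode_bounds G n erefl.
case: e e' => [[x|w] [y'|w']] [[x2|w2] [y2|w2']] //=;
  case/andP=> /eqP-> /eqP-> /andP[/eqP->] /eqP.
- by move/addnI/wcode_inj->.
- by have := ok w'; have := ok w2; lia.
- by have := ok w; have := ok w2'; lia.
- by move/wcode_inj->.
Qed.

Lemma hits_adj u y : has (hits u y) es = adj n y u.
Proof.
apply/hasP/existsP => [[[a b]]|[w /orP[] /andP[/eqP-> e_uw]]].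
- rewrite (proj2 es_ok); case: a b => [x|w] [x'|w'] //= e_ab /andP[/eqP<-
  /eqP->].
    by exists w'; rewrite /edge e_ab eqxx orbT.
  by exists w; rewrite /edge e_ab eqxx.
- by exists (inr w, inl u); rewrite ?(proj2 es_ok) //= !eqxx.
- by exists (inl u, inr w); rewrite ?(proj2 es_ok) //= !eqxx.
Qed.

Lemma count_hits u y : count (hits u y) es = adj n y u.
Proof.
rewrite -hits_adj; have [/hasP[e0 e0_es hit0]|] := boolP (has _ _).
  rewrite (eq_count (a2 := pred1 e0)) ?count_uniq_mem ?(proj1 es_ok) ?e0_es //.
  by move=> e; apply/idP/eqP => [hit|-> //]; apply: hits_inj hit hit0.
by rewrite has_count -leqNgt leqn0 => /eqP.
Qed.

Lemma edgeP e : e \in es -> (exists x w, e = (inl x, inr w)) \/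
                            (exists x w, e = (inr w, inl x)).
Proof.
rewrite (proj2 es_ok); case: e => [[x|w] [x'|w']] /E_bipartite // _.
- by left; exists x, w'.
- by right; exists x', w.
Qed.

Lemma code_pair_ok e : e \in es -> bipartite_code n0 n (code_pair e).
Proof.
case/edgeP=> [] [x [w ->]]; rewrite /bipartite_code /=;
  have := @wcode_bounds G n erefl w; have := ltn_ord (enum_rank x);
  rewrite /wcode => -> -> //; by rewrite orbT.
Qed.

Lemma row_slot e : e \in es ->
  exists u y, [/\ row n0 L D (code_pair e) = row_ptr L D u,
    slot n0 n (code_pair e) = y, n0 <= y < n + n &
    forall u' y', hits u' y' e = (u == u') && (y' == y)].
Proof.
case/edgeP=> [] [x [w ->]]; have w_ok := @wcode_bounds G n erefl w.
  have bounds : n0 <= n + wcode w < n + n by lia.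
  by exists x, (n + wcode w); rewrite /row /slot /= ltn_ord.
have bounds : n0 <= wcode w < n + n by lia.
by exists x, (wcode w); rewrite /row /slot /= ltnNge leq_addr /=;
  case/andP: bounds.
Qed.

Let cs := [seq code_pair e | e <- es].

(** The range includes the link slot [n + n], where [adj] is false; this yields the null links
    needed at the start. *)
Lemma load_row (u : V0) y : y < L ->
  load n0 n L D cs (row_ptr L D u + y) = adj n y u.
Proof.
move=> lt_y; rewrite -count_hits /load !count_map [X in _ + X](_ : _ = 0).
  rewrite addn0; apply: eq_in_count => e /row_slot[u' [y' [/= rE sE y_ok ->]]].
  rewrite rE sE; have [->|neq] := eqVneq u' u.
    by rewrite eqn_add2l eq_sym.
  by apply: negbTE; apply: row_ptr_neq => //; rewrite /L; lia.
apply/eqP; rewrite -leqn0 leqNgt -has_count; apply/hasPn => e.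
move=> /row_slot[u' [y' [/= _ -> y_ok _]]].
by have := @row_ptr_ge G L D u; rewrite /L; lia.
Qed.

(** Double counting: every edge hits exactly one row, in exactly one slot. *)
Lemma load_total y : n0 <= y < n + n ->
  load n0 n L D cs (D + y) = \sum_(u : V0) adj n y u.
Proof.
move=> y_ok; rewrite /load !count_map [X in X + _](_ : _ = 0); last first.
  apply/eqP; rewrite -leqn0 leqNgt -has_count; apply/hasPn => e.
  move=> /row_slot[u' [y' [/= -> _ _ _]]].
  by have := @row_ptr_ge G L D u'; rewrite /L; lia.
rewrite add0n (eq_bigr (fun u => \sum_(e <- es) hits u y e)); last first.
  by move=> u _; rewrite -count_hits -sum1_count big_mkcond;
    apply: eq_bigr => e; case: hits.
rewrite exchange_big -sum1_count big_mkcond !big_seq; apply: eq_bigr => e.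
move=> /row_slot[u' [y' [/= _ -> _ hE]]]; rewrite eqn_add2l eq_sym.
rewrite (bigD1 u') // hE eqxx big1 /=; first by rewrite addn0; case: eqP.
by move=> u neq; rewrite hE eq_sym (negPf neq).
Qed.

Lemma encode_edge i : i < size es ->
  nth 0 (encode es) (3 + i + i) = (nth (0, 0) cs i).1 /\
  nth 0 (encode es) (4 + i + i) = (nth (0, 0) cs i).2.
Proof.
rewrite /encode /cs -!addnA /=.
elim: (es) i => [|e s IHs] [|i] //= lt_i.
by rewrite !addnS; apply: IHs.
Qed.

Lemma size_encode : size (encode es) = D.
Proof.
rewrite /encode /D /= -addnA !addSn add0n; congr _.+3.
by elim: (es) => //= e s ->; rewrite addnS.
Qed.

Lemma size_edges : size es <= 2 * (n0 * n1).
Proof.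
have <- : #|E G| = size es.
  by rewrite -(card_uniqP (proj1 es_ok)); apply: eq_card => e;
    rewrite (proj2 es_ok).
pose f (p : V0 * V1) : V * V := (inl p.1, inr p.2).
pose g (p : V0 * V1) : V * V := (inr p.2, inl p.1).
have -> : n0 * n1 = #|{: V0 * V1}| by rewrite card_prod.
apply: (@leq_trans #|(f @: setT) :|: (g @: setT)|).
  apply/subset_leq_card/subsetP => e; rewrite -(proj2 es_ok) inE.
  case/edgeP=> [] [x [w ->]]; apply/orP; [left|right].
    by apply/imsetP; exists (x, w).
  by apply/imsetP; exists (x, w).
rewrite cardsU (leq_trans (leq_subr _ _)) // mul2n -addnn -cardsT.
by apply: leq_add; apply: leq_imset_card.
Qed.

Lemma code_lt (v : V) : code v < n.
Proof.
case: v => [x|w] /=; first by apply: leq_trans (leq_addr _ _); apply: ltn_ord.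
by rewrite ltn_add2l ltn_ord.
Qed.

(** * Assembly of the solver *)

Section Bound.
Variable B : nat.
Hypothesis leB : D + (n0 + 2) * L <= B.

Let D_gt0 : 0 < D.
Proof. by []. Qed.

Let leB2 : D + 2 * L <= B.
Proof. by apply: leq_trans leB; rewrite leq_add2l leq_mul2r leq_addl orbT. Qed.

Lemma read_header_spec :
  triple B read_header (fun=> 0, nth 0 (encode es)) 11 (fun s =>
    [/\ s.2 = nth 0 (encode es), globals n0 n L D s.1 & s.1 12 = size es]).
Proof.
apply: triple_wp; have := leB2; rewrite /D /L /n.
move=> /= leB2'; split; first by do !split; lia.
split=> //; split=> //=; lia.
Qed.

(** The output starts at address 0 and may overwrite input and rows; by then the verdict sits in
    register 9. *)
Lemma write_output_spec r m f : globals n0 n L D r -> r 9 = f -> f <= 1 ->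
  triple B write_output (r, m) (10 * n + 9) (fun s =>
    forall a, s.2 a = if a < n then f else if a < n + n then 1 - f else m a).
Proof.
move=> g r9 le_f1; have le_n : n + n <= B by move: leB2; rewrite /L; lia.
apply: (@triple_leq _ _ _ (3 + ((5 * n + 3) + (5 * n + 3)))); last by lia.
apply: (@triple_seq _ _ _ _ _ _ (fun s => exists2 r1, s = (r1, m) &
    [/\ globals n0 n L D r1, r1 14 = 0, r1 15 = 1 - f & r1 16 = f])).
  apply: triple_wp; rewrite /= r9 (reg0 g) (reg1 g) addn0.
  split; first by do !split; lia.
  by eexists; first by []; split=> //; case: g.
move=> _ [r1 -> [g1 r14 r15 r16]].
apply: triple_seq.
  by apply: (fill_spec (n1 := n1) erefl erefl leB g1 (i := 16));
    rewrite // r14; lia.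
move=> [r2 m2] [/= same2 r2_14 high m2E].
have r14_le : r2 14 + n <= B by rewrite r2_14 r14 add0n.
apply: triple_conseq (fill_spec (n1 := n1) erefl erefl leB
  (same_globals same2 isT g1) (i := 15) isT isT r14_le erefl) (leqnn _) _.
move=> [r3 m3] [/= _ _ _ m3E] a;
  rewrite m3E m2E r2_14 high // r14 r15 r16 !add0n.
by rewrite leq0n; case: (ltnP a n).
Qed.

Lemma solver_spec :
  triple B connectivity_solver (fun=> 0, nth 0 (encode es))
    (384 * (n0 * n) + 25 * size es + 500 * n0 + 30 * n + 100) (fun s =>
  exists2 f, f = 1 /\ (forall v : V, Win P0 v) \/ f = 0 /\ (forall v : V, Win
    P1 v)
    & forall a, a < n + n -> s.2 a = if a < n then f else 1 - f).
Proof.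
apply: (@triple_leq _ _ _ (11 + ((10 * n0 + 4) + ((25 * size es + 3) +
  ((20 * n + 20) + ((5 + (2 * n0 * (70 * n + 122)).+1) + (10 * n + 9)))))));
    last by lia.
apply: triple_seq read_header_spec _ => -[r m] [/= -> g r12].
set input := nth 0 (encode es).
apply: triple_seq (row_pointers_spec (n1 := n1) erefl erefl leB g (m := input))
  _.
move=> [r1 m1] [/= same1 r12' m1E].
have g1 := same_globals same1 isT g.
rewrite r12 in r12'.
have size_cs : size cs = size es by rewrite size_map.
have m1_edges i : i < size es -> m1 (3 + i + i) = input (3 + i + i) /\
    m1 (4 + i + i) = input (4 + i + i).
  by move=> lt_i; rewrite !m1E; do 2 (rewrite ifF; last by rewrite /D; lia).
have m1_0 a : D + n0 <= a -> m1 a = 0.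
  move=> le_a; rewrite m1E [a < _]ltnNge le_a andbF.
  by rewrite /input nth_default // size_encode (leq_trans (leq_addr _ _) le_a).
have load_sp : triple B load_edges (r1, m1) (25 * size cs + 3) (fun s' =>
    same_regs 11 r1 s'.1 /\ forall a, s'.2 a = m1 a + load n0 n L D cs a).
  apply: (load_edges_spec (n1 := n1)) => //; rewrite ?size_cs //.
  - by apply/allP => _ /mapP[e e_es ->]; exact: code_pair_ok.
  - by move=> i lt_i; have [-> _] := m1_edges i lt_i;
    have [] := encode_edge lt_i.
  - by move=> i lt_i; have [_ ->] := m1_edges i lt_i;
    have [] := encode_edge lt_i.
  - by move=> u lt_u; rewrite m1E leq_addr ltn_add2l lt_u addKn.
rewrite size_cs in load_sp; apply: triple_seq load_sp _ => -[r2 m2] [/= same2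
  m2E].
have g2 := same_globals same2 isT g1.
have n0_le_n : n0 <= n by apply: leq_addr.
have rep : @represents G n L D m2 id.
  split=> [u y lt_y|y y_ok].
    have lt_yL : y < L by rewrite /L; lia.
    rewrite m2E m1_0 ?load_row ?(big_pred1 u) //.
    by have := @row_ptr_ge G L D u; rewrite /L; lia.
  by rewrite m2E m1_0 ?load_total // leq_add2l; case/andP: y_ok.
have no_link (u : V0) : links n L D m2 u = 0.
  rewrite /links m2E m1_0 ?load_row //; first last.
  - by have := @row_ptr_ge G L D u; rewrite /L; lia.
  - by rewrite /L addn1.
  rewrite add0n; apply/eqP; rewrite eqb0; apply/existsP => -[w].
  have w_ok := @wcode_bounds G n erefl w.
  by case/orP=> /andP[/eqP eq_n _]; lia.
apply: triple_seq (check_degrees_spec (n1 := n1) erefl erefl leB g2 (m := m2))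
  _.
move=> [r3 _] [/= same3 -> r10].
have g3 := same_globals same3 isT g2.
apply: triple_seq (@solve_spec G B n L D erefl erefl D_gt0 leB r3 m2 g3 rep
  no_link r10) _.
move=> [r4 m4] [/= g4 settled4].
have [f r9 settled_f] : exists2 f, r4 9 = f & f = 1 /\ (forall v : V, Win P0 v)
    \/ f = 0 /\ (forall v : V, Win P1 v) by exists (r4 9).
have le_f1 : f <= 1 by case: settled_f => -[->].
apply: triple_conseq (write_output_spec g4 r9 le_f1) (leqnn _) _ => s sE.
by exists f => // a lt_a; rewrite sE lt_a.
Qed.

End Bound.

End Input.

Lemma settled_outputs (G : connectivity_game) f m :
  f = 1 /\ (forall v : vertex G, Win P0 v) \/
  f = 0 /\ (forall v : vertex G, Win P1 v) ->
  (forall a, a < (#|V0 G| + #|V1 G|) + (#|V0 G| + #|V1 G|) ->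
     m a = if a < #|V0 G| + #|V1 G| then f else 1 - f) ->
  forall r, outputs_winning_regions G (Config r.1 r.2 m).
Proof.
move=> f_ok mE r v; have lt_v := code_lt v.
rewrite /= !mE ?ltn_add2l //; last exact: leq_trans lt_v (leq_addr _ _).
rewrite lt_v ltnNge leq_addr /=; case: f_ok => -[-> win].
  split; [by left | right; split=> // win1; exact: Win_exclusive (win v) win1].
split; [right; split=> // win0; exact: Win_exclusive win0 (win v) | by left].
Qed.

Theorem theorem3 :
  exists (p : program) (C K d : nat),
  forall (G : connectivity_game) (es : seq (vertex G * vertex G)),
    lists_edges es ->
    exists t : nat,
      [/\ t <= C * time_bound #|V0 G| #|V1 G|,
          halted p (run p t (initial (encode es))),
          outputs_winning_regions G (run p t (initial (encode es)))
        & forall t' : nat,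
            words_le (K * (#|V0 G| + #|V1 G|).+1 ^ d)
                     (run p t' (initial (encode es)))].
Proof.
exists (compile 0 connectivity_solver), 2000, 11, 2 => G es es_ok.
have le_es := size_edges es_ok.
set B := 11 * _.
(* By [le_es] the input length is quadratic in the number of vertices, as is the table of rows;
   hence the exponent 2. *)
have leB : (3 + size es + size es) + (#|V0 G| + 2) *
    (#|V0 G| + #|V1 G| + (#|V0 G| + #|V1 G|) + 1) <= B.
  rewrite /B; move: le_es; move: #|V0 G| #|V1 G| (size es) => a b s; nia.
have bd : bounded B (fun=> 0, nth 0 (encode es)).
  move=> i; split=> //=.
  have [le_i|lt_i] := leqP (size (encode es)) i; first by rewrite nth_default.
  have : all (fun x => x <= B) (encode es); last by move/all_nthP; apply.
  have le_n : (#|V0 G| + #|V1 G|) + size es <= B.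
    apply: leq_trans leB; move: #|V0 G| #|V1 G| => a b; nia.
  have le_B x : x < #|V0 G| + #|V1 G| -> x <= B.
    by move=> lt_x; apply: leq_trans le_n;
      apply: leq_trans (ltnW lt_x) (leq_addr _ _).
  rewrite /encode /= !(leq_trans _ le_n) ?leq_addl //=; first last.
  - by rewrite -addnA leq_addr.
  - by rewrite addnAC leq_addl.
  apply/allP => x /flatten_mapP[e _]; rewrite !inE.
  by case/orP=> /eqP->; apply: le_B; exact: code_lt.
have [t [s [le_t halt [f f_ok sE] rnE words]]] := triple_sound bd (solver_spec
  es_ok leB).
exists t; split=> //; last first.
  by rewrite -[initial _]/(at_pc 0 (fun=> 0, nth 0 (encode es))) rnE;
    exact: settled_outputs f_ok sE (_, _).
apply: leq_trans le_t _; rewrite /time_bound.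
move: le_es; move: #|V0 G| #|V1 G| (size es) => a b k le_k.
(* The logarithmic factor is at least 1. Both maxima are at least 1, so each term of the step count
   is at most its coefficient times their product; with [k <= 2 * (a * b)] the coefficients add up
   to 384 + 50 + 500 + 30 + 100, below 2000. *)
apply: (@leq_trans (2000 * (maxn 1 (b + a) * maxn 1 a))); last first.
  by rewrite leq_mul2l leq_pmulr // leq_max.
have : a * (a + b) <= maxn 1 (b + a) * maxn 1 a.
  by rewrite mulnC leq_mul ?leq_maxr // addnC leq_maxr.
nia.
Qed.
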